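(* Let $\phi$ be a Legendre and 1-coercive dgf on $\mathbb R^n$, $X=\operatorname{dom}\phi$, $Y=\operatorname{int}\operatorname{dom}\phi$. Let $f:X\to\overline{\mathbb R}$ be proper, lsc, and $\phi$-prox-bounded with threshold $\lambda_f$, let $\lambda\in(0,\lambda_f)$, and suppose that $\operatorname{range}\overleftarrow{\mathrm{prox}}_{\lambda f}\subseteq\operatorname{int}\operatorname{dom}\phi$. Then the following are equivalent: (a) $f$ is convex. (b) $f|_{\operatorname{int}X}$ is convex. (c) $\overleftarrow{\partial}_\lambda f$ is monotone. (d) $\overleftarrow{\partial}_\lambda f$ is maximally monotone relative to $\operatorname{int}X$; that is, it is monotone and no monotone operator $T:\operatorname{int}X\rightrightarrows\mathbb R^n$ exists such that $\operatorname{gph}\overleftarrow{\partial}_\lambda f\subsetneq\operatorname{gph}T$. (e) $\langle x_1-x_2,\nabla\phi(y_1)-\nabla\phi(y_2)\rangle\ge D_\phi^{\mathrm{sym}}(x_1,x_2)$ for every $y_i\in Y$ and $x_i\in\overleftarrow{\mathrm{prox}}_{\lambda f}(y_i)$, $i=1,2$; that is, $\overleftarrow{\mathrm{prox}}_{\lambda f}$ is (single-valued and) $\mathrm B_\phi$-firmly nonexpansive. Any one of the equivalent conditions (a), (b), (c), (d), (e) implies that $\overleftarrow{\mathrm{prox}}_{\lambda f}\circ\nabla\phi^*$ is maximally monotone.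
   Context: $\overline{\mathbb R}=[-\infty,\infty]$. A distance-generating function (dgf) is a proper, lsc, convex $\phi:\mathbb R^n\to\overline{\mathbb R}$ differentiable on $\operatorname{int}\operatorname{dom}\phi\neq\emptyset$. $\phi^*$ is its convex conjugate. $D_\phi(x,y)=\phi(x)-\phi(y)-\langle\nabla\phi(y),x-y\rangle$ if $y\in Y$, and $\infty$ otherwise; $D_\phi^{\mathrm{sym}}(x,y)=D_\phi(x,y)+D_\phi(y,x)$, which equals $\langle\nabla\phi(x)-\nabla\phi(y),x-y\rangle$ if $x,y\in Y$ and $\infty$ otherwise. $\phi$ is Legendre if it is essentially smooth (differentiable on $Y\ne\emptyset$ with $\|\nabla\phi(x^k)\|\to\infty$ whenever $Y\ni x^k\to x\in\operatorname{bdry}\operatorname{dom}\phi$) and essentially strictly convex (strictly convex on every convex subset of $\operatorname{dom}\partial\phi$). $\phi$ is 1-coercive if $\liminf_{\|x\|\to\infty}\phi(x)/\|x\|=\infty$. $f:X\to\overline{\mathbb R}$ is proper if not identically $\infty$ and never $-\infty$; lsc is meant relative to $X$. For $\bar y\in Y$, $\overleftarrow{\mathrm{prox}}_{\lambda f}(\bar y)=\operatorname{argmin}_{x\in X}\{f(x)+\frac1\lambda D_\phi(x,\bar y)\}$, and $\overleftarrow{\mathrm{env}}_\lambda f(\bar y)$ is the corresponding infimum. $f$ is $\phi$-prox-bounded if $\overleftarrow{\mathrm{env}}_\lambda f(y)>-\infty$ for some $\lambda>0$, $y\in Y$; $\lambda_f$ is the supremum of all such $\lambda$. Left Bregman level proximal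 subdifferential: $\bar u\in\overleftarrow{\partial}_\lambda f(\bar x)$ iff $\bar x\in\operatorname{int}X$ and $f(x)\ge f(\bar x)+\langle\bar u,x-\bar x\rangle-\frac1\lambda D_\phi(x,\bar x)$ for all $x\in X$. A single-valued $T:Y\to X$ is $\mathrm B_\phi$-firmly nonexpansive if $\operatorname{range}T\subseteq\operatorname{int}X$ and $D_\phi^{\mathrm{sym}}(T\bar y,Ty)\le\langle T\bar y-Ty,\nabla\phi(\bar y)-\nabla\phi(y)\rangle$ for all $\bar y,y\in Y$. A set-valued $T$ is monotone if $\langle x-\bar x,y-\bar y\rangle\ge0$ for all $(x,y),(\bar x,\bar y)\in\operatorname{gph}T$, and maximally monotone if its graph is not strictly contained in the graph of another monotone operator. *)

(* Defs.v *)
From HB Require Import structures.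
From mathcomp Require Import all_boot all_order all_algebra.
From mathcomp Require Import all_classical all_reals all_analysis.
Set Implicit Arguments.
Unset Strict Implicit.
Unset Printing Implicit Defensive.
Import Order.TTheory GRing.Theory Num.Theory.
Import numFieldNormedType.Exports.
Local Open Scope classical_set_scope.
Local Open Scope ring_scope.
Local Open Scope ereal_scope.

Section Euclidean.
Context {R : realType} {n : nat}.
Implicit Types x y : 'rV[R]_n.

Definition dot x y : R := (\sum_i x ord0 i * y ord0 i)%R.

(* The library norm on 'rV[R]_n is the sup norm (same topology). *)
Definition l2norm x : R := Num.sqrt (dot x x).

Definition l2norm_infty : set_system 'rV[R]_n :=
  filter_from [set: R] (fun M => [set x | (M < l2norm x)%R]).

End Euclidean.

(* A function with values in \bar R and domain a set A is encoded as a total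
   function whose values outside A are never used. *)
Section ExtendedRealFunctions.
Context {R : realType} {n : nat}.
Local Notation V := 'rV[R]_n.
Implicit Types (A : set V) (g : V -> \bar R).

Definition edom g : set V := [set x | g x < +oo].

Definition proper_fun A g :=
  (exists2 x, A x & g x != +oo) /\ (forall x, A x -> g x != -oo).

Definition lsc_on A g := lower_semicontinuous (g : subspace A -> \bar R).

Definition econvex_on A g := forall x y (t : R), A x -> A y -> (0 < t < 1)%R ->
  g (t *: x + (1 - t) *: y)%R <= t%:E * g x + (1 - t)%:E * g y.

Definition strictly_econvex_on A g := forall x y (t : R),
  A x -> A y -> x != y -> (0 < t < 1)%R ->
  g (t *: x + (1 - t) *: y)%R < t%:E * g x + (1 - t)%:E * g y.

Definition argmin A g : set V :=
  [set x | A x /\ forall z, A z -> g x <= g z].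

(* Meaningful at the points of the interior of edom g where g is
   differentiable. *)
Definition gradient g (x : V) : V :=
  (\row_i 'D_(delta_mx ord0 i) (fine \o g) x)%R.

Definition conjugate g (v : V) : \bar R :=
  ereal_sup [set (dot v x)%:E - g x | x in [set: V]].

Definition subdifferential g (x : V) : set V :=
  [set u | forall z, g x + (dot u (z - x)%R)%:E <= g z].

Definition is_dgf g :=
  [/\ proper_fun setT g, lsc_on setT g, econvex_on setT g,
      (edom g)° !=set0 &
      forall x : V, (edom g)° x -> differentiable (fine \o g) x].

Definition essentially_smooth g :=
  [/\ (edom g)° !=set0,
      forall x : V, (edom g)° x -> differentiable (fine \o g) x &
      forall (u : nat -> V) (x : V),
        (forall k, (edom g)° (u k)) ->
        (closure (edom g) `\` (edom g)°) x ->
        u k @[k --> \oo] --> x ->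
        l2norm (gradient g (u k)) @[k --> \oo] --> +oo%R].

Definition essentially_strictly_convex g :=
  forall C : set V, convex_set C ->
    C `<=` [set x | subdifferential g x !=set0] -> strictly_econvex_on C g.

Definition legendre g :=
  essentially_smooth g /\ essentially_strictly_convex g.

Definition one_coercive g :=
  limf_einf (fun x => g x * ((l2norm x)^-1)%:E) l2norm_infty = +oo.

End ExtendedRealFunctions.

Section SetValuedOperators.
Context {R : realType} {n : nat}.
Local Notation V := 'rV[R]_n.
Implicit Types (T S : V -> set V) (A : set V).

Definition gph T : set (V * V) := [set p | T p.1 p.2].

Definition monotone_op T := forall p q, gph T p -> gph T q ->
  (0 <= dot (p.1 - q.1) (p.2 - q.2))%R.

(* Operators from A to V are those with graph in A `*` setT. *)
Definition max_monotone_rel A T :=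
  [/\ gph T `<=` A `*` setT, monotone_op T &
      ~ exists S, [/\ gph S `<=` A `*` setT, monotone_op S &
                      gph T `<` gph S]].

Definition max_monotone T := max_monotone_rel setT T.

End SetValuedOperators.

Section Bregman.
Context {R : realType} {n : nat}.
Local Notation V := 'rV[R]_n.
Variable phi : V -> \bar R.
Local Notation X := (edom phi).
Local Notation Y := ((edom phi)°).
Implicit Types (f : V -> \bar R) (lambda : R).

Definition breg (x y : V) : \bar R :=
  if y \in (Y : set V) then phi x - phi y - (dot (gradient phi y) (x - y)%R)%:E
  else +oo.

Definition breg_sym (x y : V) : \bar R := breg x y + breg y x.

Definition left_obj f lambda (y x : V) : \bar R :=
  f x + (lambda^-1)%:E * breg x y.

Definition left_prox f lambda (y : V) : set V :=
  [set x | Y y /\ argmin X (left_obj f lambda y) x].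

Definition left_env f lambda (y : V) : \bar R :=
  ereal_inf [set left_obj f lambda y x | x in X].

Definition prox_bound_at f lambda :=
  (0 < lambda)%R /\ exists2 y, Y y & -oo < left_env f lambda y.

Definition prox_bounded f := exists lambda, prox_bound_at f lambda.

Definition prox_threshold f : \bar R :=
  ereal_sup [set lambda%:E | lambda in [set l | prox_bound_at f l]].

Definition left_subdiff f lambda (x : V) : set V :=
  [set u | X° x /\ forall z, X z ->
     f x + (dot u (z - x)%R)%:E - (lambda^-1)%:E * breg z x <= f z].

Definition breg_firmly_nonexpansive (T : V -> V) :=
  (forall y : V, Y y -> X° (T y)) /\
  (forall y1 y2 : V, Y y1 -> Y y2 ->
     breg_sym (T y1) (T y2) <=
     (dot (T y1 - T y2)%R (gradient phi y1 - gradient phi y2)%R)%:E).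

End Bregman.

(* Main.v *)
Require Import Defs.
From HB Require Import structures.
From mathcomp Require Import all_boot all_order all_algebra.
From mathcomp Require Import all_classical all_reals all_analysis.
From mathcomp Require Import ring lra.
Set Implicit Arguments.
Unset Strict Implicit.
Unset Printing Implicit Defensive.
Import Order.TTheory GRing.Theory Num.Theory.
Import numFieldNormedType.Exports.
Local Open Scope classical_set_scope.
Local Open Scope ring_scope.

(** Everything is read off the function [g = phi + lambda f], extended by [+oo]
    outside [dom phi] ([dgf_sum]).  Completing the Bregman distances shows that
    [x] is a proximal point of [y] iff [grad phi y] is a global subgradient of
    [g] at [x] ([left_prox_subdiff]), and that [u] is a level proximal
    subgradient of [f] at [x] iff [grad phi x + lambda u] is one
    ([left_subdiff_subdiff]).  Since [phi] is Legendre and 1-coercive,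
    [grad phi] is a bijection from [int dom phi] onto the whole space with
    inverse [grad phi^*] ([gradient_surj], [gradient_conjugate]).  So
    monotonicity of the level proximal subdifferential and the firm
    nonexpansiveness inequality are one and the same property of the
    subgradients of [g], here called [rel_monotone]:
      <x - y, grad phi x - grad phi y> <= <x - y, u - v>
    for all subgradients [u] of [g] at [x] and [v] of [g] at [y].

    The threshold condition makes [g] lower semicontinuous and super-coercive,
    so that every vector is a subgradient of [g] at some point, namely at a
    minimizer of a tilt of [g].  By strict monotonicity of [grad phi],
    [rel_monotone] makes this minimizer unique.

    The substantial implication is from [rel_monotone] to convexity of [f].
    Uniqueness implies that the minimizer depends continuously on the tilt
    ([subdiff_stable]), and then minimizing [g^* + |.|^2/2k - <w,.>] solves the
    resolvent inclusion: for all [w] and [k > 0] some point [x_k] has [k (w - x_k)]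
    as a subgradient of [g] ([subdiff_resolvent]).  These points tend to [w] under
    a mild bound ([subdiff_penalty]), and they replace [w] in all arguments in
    which a subgradient at [w] is wanted:
    - the subgradient inequalities at [x_k] tested at [a] and [b], with
      [w = t a + (1-t) b], give convexity of [g] in the limit
      ([supercoercive_econvex]);
    - [rel_monotone] between a fixed [x] and the points [x_k] near the segment
      from [x] to [z] bounds the slopes of [g] along that segment below by those
      of [phi] ([slope_step]); summing up, each subgradient inequality of [g]
      holds with the additional term [D_phi(z,x)] ([rel_strong_subdiff]);
    - these strengthened inequalities at [x_k], tested at [a] and [b], give
      convexity of [g - phi] in the limit ([rel_convex]).

    Maximality is Minty's argument: a pair [(x, u)] monotonically related to the
    graph is compared with the solution of an inclusion.  For the level proximal
    subdifferential that solution is the minimizer of the tilt of [g] by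
    [grad phi x + lambda u]; for the proximal map composed with [grad phi^*] it
    is given by the resolvent ([max_monotone_subdiff]). *)

(** * Inner products and the sup norm *)

Lemma near_dist {R : realType} {V : normedModType R} (x : V) (e : R) :
  0 < e -> \forall y \near x, `|y - x| < e.
Proof. by move=> e0; apply/nbhs_normP; exists e => // y; rewrite /= distrC. Qed.

Lemma nbhs_dist {R : realType} {V : normedModType R} (x : V) (P : set V) :
  nbhs x P -> exists2 e : R, 0 < e & forall y, `|y - x| < e -> P y.
Proof.
by move=> /nbhs_normP[e e0 eP]; exists e => // y; rewrite distrC; exact: eP.
Qed.

Section dot_theory.
Context {R : realType} {n : nat}.
Implicit Types (x y z u : 'rV[R]_n) (t : R).

Lemma dotC x y : dot x y = dot y x.
Proof. by apply: eq_bigr => i _; rewrite mulrC. Qed.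

Lemma dotDl x y z : dot (x + y) z = dot x z + dot y z.
Proof. by rewrite /dot -big_split; apply: eq_bigr => i _; rewrite mxE mulrDl. Qed.

Lemma dotZl t x y : dot (t *: x) y = t * dot x y.
Proof. by rewrite /dot mulr_sumr; apply: eq_bigr => i _; rewrite mxE mulrA. Qed.

Lemma dotNl x y : dot (- x) y = - dot x y.
Proof. by rewrite -scaleN1r dotZl mulN1r. Qed.

Lemma dotBl x y z : dot (x - y) z = dot x z - dot y z.
Proof. by rewrite dotDl dotNl. Qed.

Lemma dotDr x y z : dot x (y + z) = dot x y + dot x z.
Proof. by rewrite dotC dotDl !(dotC x). Qed.

Lemma dotZr t x y : dot x (t *: y) = t * dot x y.
Proof. by rewrite dotC dotZl dotC. Qed.

Lemma dotNr x y : dot x (- y) = - dot x y.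
Proof. by rewrite dotC dotNl dotC. Qed.

Lemma dotBr x y z : dot x (y - z) = dot x y - dot x z.
Proof. by rewrite dotDr dotNr. Qed.

Definition dotE := (dotDl, dotDr, dotBl, dotBr, dotNl, dotNr, dotZl, dotZr).

Lemma dot0l x : dot 0 x = 0.
Proof. by rewrite -(scale0r x) dotZl mul0r. Qed.

Lemma dot0r x : dot x 0 = 0.
Proof. by rewrite dotC dot0l. Qed.

Lemma norm_coord x i : `|x ord0 i| <= `|x|.
Proof.
rewrite [leRHS]/Num.norm /= mx_normrE.
by apply/bigmax_geP; right => /=; exists (ord0, i).
Qed.

Lemma norm_leP x t : 0 <= t -> (forall i, `|x ord0 i| <= t) -> `|x| <= t.
Proof.
move=> t0 xt; rewrite [leLHS]/Num.norm /= mx_normrE.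
by apply: bigmax_le => // -[i j] _ /=; rewrite (ord1 i).
Qed.

(** The dual of the sup norm, which is the norm of the topology used here. *)
Definition norm1 u : R := \sum_i `|u ord0 i|.

Lemma norm1_ge0 u : 0 <= norm1 u.
Proof. exact: sumr_ge0. Qed.

Lemma dot_le_norm u x : `|dot u x| <= norm1 u * `|x|.
Proof.
apply: le_trans (ler_norm_sum _ _ _) _; rewrite mulr_suml.
by apply: ler_sum => i _; rewrite normrM ler_wpM2l// norm_coord.
Qed.

Lemma dotxx_ge0 x : 0 <= dot x x.
Proof. by apply: sumr_ge0 => i _; rewrite -expr2 sqr_ge0. Qed.

Lemma sqr_norm_le_dot x : `|x| ^+ 2 <= dot x x.
Proof.
rewrite -(@sqr_sqrtr _ (dot x x)) ?dotxx_ge0// ler_pXn2r ?nnegrE ?sqrtr_ge0//.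
apply: norm_leP => [|i]; first exact: sqrtr_ge0.
rewrite -sqrtr_sqr ler_sqrt ?dotxx_ge0// /dot (bigD1 i)//= -expr2 lerDl.
by apply: sumr_ge0 => j _; rewrite -expr2 sqr_ge0.
Qed.

Lemma norm_le_l2norm x : `|x| <= l2norm x.
Proof.
rewrite -(@ler_pXn2r _ 2) ?nnegrE ?sqrtr_ge0// sqr_sqrtr ?dotxx_ge0//.
exact: sqr_norm_le_dot.
Qed.

Lemma dotxx_le0 x : dot x x <= 0 -> x = 0.
Proof.
move=> xx; apply/normr0_eq0.
have := sqr_norm_le_dot x; have := normr_ge0 x; nra.
Qed.

Lemma dot_delta x i : dot x (delta_mx ord0 i) = x ord0 i.
Proof.
rewrite /dot (bigD1 i)//= big1 ?addr0 ?mxE ?eqxx ?mulr1//.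
by move=> j ji; rewrite mxE eqxx (negbTE ji) mulr0.
Qed.

Lemma dot_inj x y : (forall d, dot x d = dot y d) -> x = y.
Proof. by move=> xy; apply/rowP => i; rewrite -!dot_delta. Qed.

Lemma near_dot u x e : 0 < e -> \forall y \near x, `|dot u (y - x)| < e.
Proof.
move=> e0; have u1 : 0 < norm1 u + 1 by rewrite ltr_wpDl// norm1_ge0.
apply: filterS (near_dist x (divr_gt0 e0 u1)) => y.
rewrite ltr_pdivlMr// => H; apply: le_lt_trans (dot_le_norm _ _) (le_lt_trans _ H).
by rewrite mulrC ler_wpM2l// lerDl.
Qed.

End dot_theory.

(** * Lower semicontinuous functions *)

Section lsc.
Local Open Scope ereal_scope.
Context {R : realType}.

(** A strict lower bound on a sum splits over its terms; this reduces lower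
    semicontinuity of a sum to that of the terms, infinite values included. *)
Lemma lt_adde_split (a : R) (x y : \bar R) : -oo < x -> -oo < y -> a%:E < x + y ->
  exists b c : R, [/\ b%:E < x, c%:E < y & (a <= b + c)%R].
Proof.
case: x y => [r| |] [s| |]//=.
- rewrite -EFinD lte_fin => _ _ ars.
  exists (r - (r + s - a) / 2)%R, (s - (r + s - a) / 2)%R.
  by rewrite !lte_fin; split; lra.
- move=> _ _ _; exists (r - 1)%R, (a - r + 1)%R.
  by rewrite lte_fin ltry; split => //; lra.
- move=> _ _ _; exists (a - s + 1)%R, (s - 1)%R.
  by rewrite lte_fin ltry; split => //; lra.
- by move=> _ _ _; exists a, 0%R; rewrite !ltry addr0.
Qed.

Context {T : topologicalType}.
Implicit Types h : T -> \bar R.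

Lemma lsc_near h x (a : R) : lower_semicontinuous h -> a%:E < h x ->
  \forall y \near x, a%:E < h y.
Proof. by move=> lsch /lsch[V xV Va]; apply: filterS xV. Qed.

Lemma lsc_add h1 h2 : (forall x, -oo < h1 x) -> (forall x, -oo < h2 x) ->
  lower_semicontinuous h1 -> lower_semicontinuous h2 ->
  lower_semicontinuous (fun x => h1 x + h2 x).
Proof.
move=> h1y h2y lsc1 lsc2 x a /lt_adde_split[//|//|b [c [bx cx abc]]].
exists ([set y | b%:E < h1 y] `&` [set y | c%:E < h2 y]).
  by apply: filterI; exact: lsc_near.
move=> y [/= hb hc]; apply: le_lt_trans (lteD hb hc).
by rewrite -EFinD lee_fin.
Qed.

Lemma lsc_cvg_le (I : Type) (F : set_system I) {FF : ProperFilter F} h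
    (u : I -> T) p (B : \bar R) : lower_semicontinuous h -> u @ F --> p ->
  (\forall i \near F, h (u i) <= B) -> h p <= B.
Proof.
move=> lsch up hB; rewrite leNgt; apply/negP => Bp.
have [a Ba ap] : exists2 a : R, B <= a%:E & a%:E < h p.
  move: Bp; case: B {hB} => [b| |]; [by exists b|by rewrite ltNge leey|].
  case: (h p) => [r| |]//= _; last by exists 0%R; rewrite ?leNye// ltry.
  by exists (r - 1)%R; rewrite ?leNye// lte_fin; lra.
have aF : \forall i \near F, a%:E < h (u i).
  exact: (up _ (lsc_near lsch ap)).
have [i [/= ai Bi]] := filter_ex (filterI aF hB).
by have := lt_le_trans ai (le_trans Bi Ba); rewrite ltxx.
Qed.

(** The sublevel sets through the points of [K] form a filter base on [K]; any of
    its cluster points is a minimizer. *)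
Lemma lsc_compact_min h (K : set T) : lower_semicontinuous h -> compact K ->
  K !=set0 -> exists2 p, K p & forall z, K z -> h p <= h z.
Proof.
move=> lsch cK [z0 Kz0].
pose D := [set z | K z]; pose B z := K `&` [set x | h x <= h z].
have FF : ProperFilter (filter_from D B).
  apply: filter_from_proper; last by move=> z Kz; exists z; split => /=.
  apply: filter_from_filter; first by exists z0.
  move=> x y Kx Ky; have [xy|/ltW yx] := leP (h x) (h y).
    by exists x => // t [Kt /= tx]; split; split => //=; exact: le_trans tx xy.
  by exists y => // t [Kt /= ty]; split; split => //=; exact: le_trans ty yx.
have [|p [Kp clp]] := cK _ FF.
  by exists z0 => // x [].
exists p => // z Kz; rewrite leNgt; apply/negP => zp.
have [a za ap] : exists2 a : R, h z <= a%:E & a%:E < h p.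
  move: zp; case: (h z) => [b| |]; [by exists b|by rewrite ltNge leey|].
  case: (h p) => [r| |]//= _; last by exists 0%R; rewrite ?leNye// ltry.
  by exists (r - 1)%R; rewrite ?leNye// lte_fin; lra.
have [||x [[_ /= xz] ax]] := clp (B z) [set y | a%:E < h y].
- by exists z.
- exact: lsc_near.
by have := lt_le_trans ax (le_trans xz za); rewrite ltxx.
Qed.

End lsc.

(** * Super-coercive functions and their global subgradients *)

Section supercoercive.
Local Open Scope ereal_scope.
Context {R : realType} {n : nat}.
Local Notation V := 'rV[R]_n.
Implicit Types (h g : V -> \bar R) (u v w x y z p : V).

Lemma norm1_le u : (norm1 u <= n%:R * `|u|)%R.
Proof.
apply: (@le_trans _ _ (\sum_(i < n) `|u|))%R.
  by apply: ler_sum => i _; exact: norm_coord.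
by rewrite sumr_const card_ord mulr_natl.
Qed.

Lemma closed_norm_le (r : R) : closed [set x : V | (`|x| <= r)%R].
Proof.
move=> x clx /=; rewrite leNgt; apply/negP => rx.
have e0 : (0 < `|x| - r)%R by rewrite subr_gt0.
have [y [/= yr]] := clx _ (near_dist x e0).
by have := lerB_dist x y; rewrite (distrC x); lra.
Qed.

Lemma compact_norm_le (r : R) : compact [set x : V | (`|x| <= r)%R].
Proof.
apply: bounded_closed_compact; last exact: closed_norm_le.
exists r; split; first exact: num_real.
by move=> M rM x /= /le_trans; apply; exact: ltW.
Qed.

Lemma lsc_EFin (f : V -> R) :
  (forall x (e : R), (0 < e)%R -> \forall y \near x, (f x - e < f y)%R) ->
  lower_semicontinuous (EFin \o f).
Proof.
move=> fP x a; rewrite lte_fin => ax.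
exists [set y | (a < f y)%R]; last by move=> y; rewrite lte_fin.
have := fP x (f x - a)%R; rewrite subr_gt0 => /(_ ax).
by rewrite subKr.
Qed.

Lemma lsc_dot v : lower_semicontinuous (fun x => (dot v x)%:E).
Proof.
apply: lsc_EFin => x e e0; apply: filterS (near_dot v x e0) => y.
by rewrite ltr_norml dotBr; lra.
Qed.

(** Linear growth confines the search for a minimizer to a closed ball. *)
Lemma coercive_min h (C : R) : lower_semicontinuous h ->
  (forall x, (`|x| - C)%:E <= h x) -> exists p, forall z, h p <= h z.
Proof.
move=> lsch hC.
have [[x0 x0y]|hy] := pselect (exists x, h x < +oo); last first.
  exists 0%R => z; have -> : h z = +oo; last exact: leey.
  by apply: contrapT => /eqP; rewrite -ltey => hz; apply: hy; exists z.
have [r hr] : exists r, h x0 = r%:E.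
  have := hC x0; case: (h x0) x0y => // r; by exists r.
have [|p _ minp] := lsc_compact_min lsch (compact_norm_le (r := (r + C)%R)).
  by exists x0 => /=; have := hC x0; rewrite hr lee_fin; lra.
exists p => z; have [zr|zr] := leP `|z|%R (r + C)%R; first exact: minp.
apply: le_trans (minp x0 _) (le_trans _ (hC z)).
  by rewrite /=; have := hC x0; rewrite hr lee_fin; lra.
by rewrite hr lee_fin; lra.
Qed.

(** The constant makes the bound hold everywhere, and not only far away: this
    is 1-coercivity together with a lower bound on bounded sets. *)
Definition supercoercive g := forall M : R,
  exists C : R, forall x, (M * `|x| - C)%:E <= g x.

Lemma supercoercive_gtNy g x : supercoercive g -> -oo < g x.
Proof. by move=> /(_ 0%R)[C gC]; apply: lt_le_trans (gC x); rewrite ltNyr. Qed.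

Lemma subdiff_le g x v z (a b : R) : subdifferential g x v ->
  g x = a%:E -> g z = b%:E -> (a + dot v (z - x) <= b)%R.
Proof. by move=> xv ga gb; have := xv z; rewrite ga gb -EFinD lee_fin. Qed.

Section theory.
Variables (g : V -> \bar R) (x0 : V).
Hypotheses (glsc : lower_semicontinuous g) (gsc : supercoercive g)
  (gx0 : g x0 < +oo).

Lemma subdiff_fin x v : subdifferential g x v -> exists a : R, g x = a%:E.
Proof.
move=> /(_ x0); have := supercoercive_gtNy x gsc.
case: (g x) => // [a _ _|_]; first by exists a.
by rewrite addye// leye_eq => /eqP gx; move: gx0; rewrite gx.
Qed.

(** A global subgradient [v] at [x] means that [x] minimizes [g - <v,.>]. *)
Lemma subdiff_exists v : exists x, subdifferential g x v.
Proof.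
pose h x := g x + (dot (- v)%R x)%:E.
have [C gC] := gsc (norm1 v + 1)%R.
have [||p minp] := @coercive_min h C.
- apply: lsc_add => //; [by move=> x; exact: supercoercive_gtNy| |exact: lsc_dot].
  by move=> x; rewrite ltNyr.
- move=> x; have := leeD2r (dot (- v)%R x)%:E (gC x); apply: le_trans.
  rewrite -EFinD lee_fin dotNl.
  by have := dot_le_norm v x; rewrite ler_norml; lra.
have [a ga] : exists a : R, g p = a%:E.
  have := minp x0; have := supercoercive_gtNy p gsc; rewrite /h.
  case: (g p) => // [a _ _|_]; first by exists a.
  by rewrite addye// leye_eq; case: (g x0) gx0.
exists p => z; have := minp z; have := supercoercive_gtNy z gsc; rewrite /h ga.
case: (g z) => // [b _|_ _]; last by rewrite leey.
by rewrite -!EFinD !lee_fin !dotE; lra.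
Qed.

(** If [p] is the only minimizer of [g - <v,.>], then on the compact set of the
    points away from [p] and within the a priori bound this function exceeds its
    minimum by a positive gap, which a small change of [v] cannot close. *)
Lemma subdiff_stable v p : subdifferential g p v ->
    (forall x, subdifferential g x v -> x = p) ->
  forall e : R, (0 < e)%R -> exists2 d : R, (0 < d)%R &
    forall w x, (`|w - v| < d)%R -> subdifferential g x w -> (`|x - p| < e)%R.
Proof.
move=> vp uniq_p e e0; have [a ga] := subdiff_fin vp.
set q : R := n%:R; have q0 : (0 <= q)%R by exact: ler0n.
have [C gC] := gsc (norm1 v + q + 1)%R.
set rho : R := (a + C + (norm1 v + q) * `|p|)%R.
(* The growth rate norm1 v + q + 1 exceeds by 1 what tilts at distance at most 1
   from v can compensate, so all their minimizers lie in one ball. *)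
have bound w x : (`|w - v| <= 1)%R -> subdifferential g x w -> (`|x| <= rho)%R.
  move=> wv wx; have [b gb] := subdiff_fin wx.
  have := subdiff_le wx gb ga; have := gC x; rewrite gb lee_fin.
  have := dot_le_norm v (p - x)%R; have := dot_le_norm (w - v)%R (p - x)%R.
  have := ler_normB p x; have := norm1_le (w - v)%R; rewrite -/q.
  have -> : (dot w (p - x) = dot v (p - x) + dot (w - v) (p - x))%R.
    by rewrite (dotBl w); lra.
  rewrite !ler_norml => H1 H2 /andP[H3 _] /andP[H4 _] H5 H6.
  have N0 := normr_ge0 (p - x)%R; have N1 := norm1_ge0 v.
  have K1 : (norm1 (w - v) * `|p - x| <= q * (`|p| + `|x|))%R.
    apply: ler_pM => //; first exact: norm1_ge0.
    by apply: le_trans H1 _; rewrite -[leRHS]mulr1 ler_wpM2l.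
  have K2 : (norm1 v * `|p - x| <= norm1 v * (`|p| + `|x|))%R by apply: ler_wpM2l.
  rewrite /rho; lra.
pose h x := g x + (dot (- v)%R x)%:E.
have lsch : lower_semicontinuous h.
  apply: lsc_add => //; [by move=> x; exact: supercoercive_gtNy| |exact: lsc_dot].
  by move=> x; rewrite ltNyr.
pose K := [set x : V | (`|x| <= rho)%R] `&` ~` [set x | (`|x - p| < e)%R].
have cK : compact K.
  apply: compact_closedI; first exact: compact_norm_le.
  apply: open_closedC; rewrite openE => x /= xpe.
  have e1 : (0 < e - `|x - p|)%R by rewrite subr_gt0.
  apply: filterS (near_dist x e1) => y /=.
  by have := ler_distD x y p; lra.
have [K0|K0] := pselect (K !=set0); last first.
  exists 1%R => // w x wv wx; apply: contrapT => nxe; apply: K0; exists x.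
  by split => //=; apply: bound wx; exact: ltW.
have [s [s1 s2] mins] := lsc_compact_min lsch cK K0.
have hps : h p < h s.
  rewrite ltNge; apply/negP => hsp; apply: s2 => /=.
  rewrite (uniq_p s) ?subrr ?normr0// => z.
  have := vp z; move: hsp; have := supercoercive_gtNy s gsc.
  have := supercoercive_gtNy z gsc; rewrite /h ga.
  case: (g z) => // [b _|_ _ _ _]; last by rewrite leey.
  case: (g s) => //= c _.
  by rewrite -!EFinD !lee_fin !dotE; lra.
have [b pb bs] : exists2 b : R, (a - dot v p < b)%R & b%:E <= h s.
  move: hps; rewrite /h ga; case: (g s) => [c| |]//=.
    rewrite -!EFinD lte_fin => acs; exists (c + dot (- v) s)%R => //.
    by move: acs; rewrite !dotNl.
  by move=> _; exists (a - dot v p + 1)%R; rewrite ?addye ?leey//; lra.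
have rp0 : (0 <= `|rho| + `|p|)%R by rewrite addr_ge0.
have D0 : (0 < q * (`|rho| + `|p|) + 1)%R by rewrite ltr_wpDl// mulr_ge0.
exists (Num.min 1 ((b - (a - dot v p)) / (q * (`|rho| + `|p|) + 1)))%R.
  by rewrite lt_min ltr01 divr_gt0// subr_gt0.
move=> w x; rewrite lt_min => /andP[w1]; rewrite ltr_pdivlMr// => wd wx.
have xr := bound _ _ (ltW w1) wx.
apply: contrapT => nxe; have := mins x (conj xr nxe).
have [c gc] := subdiff_fin wx.
move=> /(le_trans bs); rewrite /h gc -EFinD lee_fin dotNl.
have := subdiff_le wx gc ga.
have -> : (dot w (p - x) = dot v (p - x) + dot (w - v) (p - x))%R.
  by rewrite (dotBl w); lra.
have := dot_le_norm (w - v)%R (p - x)%R; rewrite ler_norml => /andP[+ _].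
have : (norm1 (w - v) * `|p - x| <= q * `|w - v| * (`|rho| + `|p|))%R.
  apply: ler_pM => //; [exact: norm1_ge0|exact: norm1_le|].
  by have := ler_normB p x; have := ler_norm rho; lra.
rewrite !dotBr; have := normr_ge0 (w - v)%R; nra.
Qed.

Hypothesis guniq : forall v x y,
  subdifferential g x v -> subdifferential g y v -> x = y.

(** The vector [v = k (w - x)] minimizes [g^* + |.|^2/2k - <w,.>], where
    [g^* v = <v, T v> - g (T v)] and [T v] is the point with subgradient [v].
    Optimality of [v] tested in the direction of the residual
    [r = w - v/k - T v] gives [|r|^2 <= <r, T (v + t r) - T v> + O(t)], and [T] is
    continuous, so [r = 0]. *)
Lemma subdiff_resolvent w (k : R) : (0 < k)%R ->
  exists x, subdifferential g x (k *: (w - x))%R.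
Proof.
move=> k0; have [T TP] := choice subdiff_exists.
have [gT gTE] := choice (fun v => subdiff_fin (TP v)).
pose e v := (dot v (T v) - gT v)%R.
have eP v u : (dot v (T u) - gT u <= e v)%R.
  by have := subdiff_le (TP v) (gTE v) (gTE u); rewrite /e dotBr; lra.
pose h v := ((2 * k)^-1 * dot v v - dot w v + e v)%R.
have K0 : (0 < (2 * k)^-1)%R by rewrite invr_gt0 mulr_gt0.
have h_lsc : lower_semicontinuous (EFin \o h).
  apply: lsc_EFin => x r r0.
  apply: filterS (near_dot (k^-1 *: x - w + T x)%R x r0) => y.
  rewrite ltr_norml => /andP[+ _]; rewrite /h.
  have := eP y x; have := dotxx_ge0 (y - x)%R; rewrite [e x]/e !dotE (dotC y x).
  rewrite invfM; move=> A1 A2.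
  have A3 : (0 <= 2^-1 * k^-1 * (dot y y - dot x y - (dot x y - dot x x)))%R.
    by rewrite mulr_ge0// -invfM ltW.
  rewrite (dotC (T x) y) (dotC (T x) x); lra.
have [|v minv] := @coercive_min (EFin \o h)
  (gT 0 + k / 2 * (norm1 (T 0 - w)%R + 1) ^+ 2)%R h_lsc.
  move=> v /=; rewrite lee_fin /h.
  have := eP v 0%R; have := dot_le_norm (T 0 - w)%R v.
  have := sqr_norm_le_dot v; rewrite ler_norml dotBl (dotC v).
  move=> A1 /andP[A2 _] A3.
  set S := norm1 (T 0%R - w)%R; set N := (`|v|)%R.
  have : (0 <= (2 * k)^-1 * (N - k * (S + 1)) ^+ 2)%R.
    by rewrite mulr_ge0 ?sqr_ge0// ltW.
  have -> : ((2 * k)^-1 * (N - k * (S + 1)) ^+ 2 =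
      (2 * k)^-1 * N ^+ 2 - N * (S + 1) + k / 2 * (S + 1) ^+ 2)%R.
    by field; rewrite gt_eqF.
  have : ((2 * k)^-1 * N ^+ 2 <= (2 * k)^-1 * dot v v)%R by rewrite ler_wpM2l// ltW.
  rewrite -/S -/N in A2; lra.
exists (T v).
suff -> : (k *: (w - T v))%R = v by exact: TP.
have [r rE] : exists r, r = (w - k^-1 *: v - T v)%R by eexists.
suff r0 : r = 0%R.
  have -> : (w - T v = r + k^-1 *: v)%R by rewrite rE addrAC addrNK.
  by rewrite r0 add0r scalerA mulfV ?scale1r// gt_eqF.
apply: dotxx_le0; rewrite leNgt; apply/negP => q0; set q := dot r r in q0.
have N0 : (0 < norm1 r + 1)%R by rewrite ltr_wpDl// norm1_ge0.
have E0 : (0 < q / 4 / (norm1 r + 1))%R by rewrite !divr_gt0.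
have [d d0 dP] := subdiff_stable (TP v) (fun x xv => guniq xv (TP v)) E0.
set t := Num.min (k / 2)%R (d / (2 * (`|r| + 1)))%R.
have r1 : (0 < 2 * (`|r| + 1))%R by rewrite mulr_gt0// ltr_wpDl.
have t0 : (0 < t)%R by rewrite lt_min !divr_gt0.
have tk : (t <= k / 2)%R by rewrite ge_min lexx.
have td : (t * (2 * (`|r| + 1)) <= d)%R by rewrite -ler_pdivlMr// ge_min lexx orbT.
have := dP (v + t *: r)%R (T (v + t *: r)%R) _ (TP _).
rewrite (addrC v) addrK normrZ (gtr0_norm t0) => /(_ _) /wrap[|xt].
  by have := normr_ge0 r; nra.
have := minv (t *: r + v)%R; rewrite /= lee_fin /h.
have := eP v (t *: r + v)%R; rewrite [e (t *: r + v)%R]/e.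
move: (T (t *: r + v)%R) xt (gT (t *: r + v)%R) => x xt G A1 A2.
have A3 : (dot r (x - T v) <= q / 4)%R.
  have := dot_le_norm r (x - T v)%R; rewrite ler_norml => /andP[_].
  move=> /le_trans; apply.
  by move: xt; rewrite ltr_pdivlMr//; have := normr_ge0 (x - T v)%R; nra.
have A4 : (dot r r = dot w r - k^-1 * dot v r - dot r (T v))%R.
  by rewrite {1}rE !dotE (dotC r (T v)).
have A5 : ((2 * k)^-1 * t <= 4^-1)%R by rewrite mulrC ler_pdivrMr ?mulr_gt0//; lra.
have A6 : (dot r (x - T v) = dot r x - dot r (T v))%R by rewrite dotBr.
have A7 : (0 <= -q + dot r (x - T v) + (2 * k)^-1 * t * q)%R.
  rewrite -(@pmulr_rge0 _ t)//.
  have -> : (t * (- q + dot r (x - T v) + (2 * k)^-1 * t * q) = 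
     ((2 * k)^-1 * dot (t *: r + v) (t *: r + v) - dot w (t *: r + v) +
       (dot (t *: r + v) x - G)) -
     ((2 * k)^-1 * dot v v - dot w v + (dot v x - G)))%R.
    have -> : dot w (t *: r + v) =
        (t * (q + k^-1 * dot v r + dot r (T v)) + dot w v)%R.
      by rewrite /q A4 !dotE; ring.
    by rewrite A6 !dotE (dotC r v) invfM -/q; field; rewrite gt_eqF.
  lra.
have := ler_wpM2r (ltW q0) A5; lra.
Qed.

(** A bound on [g x_k + k |w - x_k|^2] forces [x_k] to converge to [w], because [g]
    is bounded below; semicontinuity transfers the bound to [g w]. *)
Lemma subdiff_penalty (x_ : nat -> V) w (B : R) :
  (forall k, subdifferential g (x_ k) (k.+1%:R *: (w - x_ k))%R) ->
  (forall k, g (x_ k) + (k.+1%:R * dot (w - x_ k) (w - x_ k))%:E <= B%:E) ->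
  x_ @ \oo --> w /\ g w <= B%:E.
Proof.
move=> sub gB; have [C gC] := gsc 0%R.
have bnd k : (k.+1%:R * `|w - x_ k| ^+ 2 <= B + C)%R.
  have [a ga] := subdiff_fin (sub k).
  have := gB k; have := gC (x_ k); rewrite ga -EFinD !lee_fin mul0r.
  have := ler_wpM2l (ler0n R k.+1) (sqr_norm_le_dot (w - x_ k)%R); lra.
have xw : x_ @ \oo --> w.
  apply/cvgrPdist_lt => e e0.
  have BC : (0 < `|B + C| + 1)%R by rewrite ltr_wpDl.
  have E0 : (0 < e ^+ 2 / (`|B + C| + 1))%R by rewrite divr_gt0// exprn_gt0.
  apply: filterS (near_infty_natSinv_lt (PosNum E0)) => k /=.
  rewrite ltr_pdivlMr// => kE; rewrite -(@ltr_pXn2r _ 2) ?nnegrE ?(ltW e0)//.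
  have K0 : (0 < k.+1%:R :> R)%R by [].
  rewrite -(ltr_pM2l K0); apply: (le_lt_trans (bnd k)).
  move: kE; rewrite mulrC ltr_pdivrMr// mulrC; apply: le_lt_trans.
  by have := ler_norm (B + C)%R; lra.
split=> //; apply: (lsc_cvg_le glsc xw); apply: nearW => k.
apply: le_trans (gB k); rewrite leeDl// lee_fin mulr_ge0//.
exact: dotxx_ge0.
Qed.

Lemma subdiff_resolvent_seq w : exists x_ : nat -> V,
  forall k, subdifferential g (x_ k) (k.+1%:R *: (w - x_ k))%R.
Proof.
have ex k : exists x, subdifferential g x (k.+1%:R *: (w - x))%R.
  exact: subdiff_resolvent.
by have [x_ x_P] := choice ex; exists x_.
Qed.

(** Average the subgradient inequalities at the resolvent points [x_k] of
    [m = t a + (1-t) b], tested at [a] and [b]: the linear terms add up to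
    [k |m - x_k|^2], which is what [subdiff_penalty] needs.  In particular finiteness
    of [g m] is a conclusion. *)
Lemma supercoercive_econvex : econvex_on setT g.
Proof.
move=> a b t _ _ /andP[t0 t1]; set m := (_ + _)%R.
have t1' : (0 < 1 - t)%R by rewrite subr_gt0.
have := supercoercive_gtNy a gsc; have := supercoercive_gtNy b gsc.
case gb : (g b) => [B| |] // _; case ga : (g a) => [A| |] // _;
  try by rewrite ?gt0_muley ?lte_fin// -?EFinM ?addey// ?addye// leey.
have [x_ sub] := subdiff_resolvent_seq m.
have [|_] := @subdiff_penalty x_ m (t * A + (1 - t) * B)%R sub; last first.
  by rewrite EFinD !EFinM.
move=> k; have [c gc] := subdiff_fin (sub k).
have := ler_wpM2l (ltW t0) (subdiff_le (sub k) gc ga).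
have := ler_wpM2l (ltW t1') (subdiff_le (sub k) gc gb).
rewrite gc -EFinD lee_fin.
have E z y : dot z (m - y) = (t * dot z (a - y) + (1 - t) * dot z (b - y))%R.
  by rewrite /m !dotE; ring.
by rewrite E !dotZl; lra.
Qed.

End theory.
End supercoercive.

(** * Distance-generating functions *)

Lemma gradient_cvg {R : realType} {n : nat} (g : 'rV[R]_n -> \bar R)
    (y d : 'rV[R]_n) (e : R) : differentiable (fine \o g) y -> 0 < e ->
  exists2 r : R, 0 < r & forall t, `|t| < r ->
    `|fine (g (y + t *: d)) - fine (g y) - t * dot (gradient g y) d| <= e * `|t|.
Proof.
move=> dg e0; set F := fine \o g in dg.
have dE : 'D_d F y = dot (gradient g y) d.
  rewrite deriveE// {1}(row_sum_delta d) linear_sum; apply: eq_bigr => i _.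
  by rewrite linearZ /= mulrC mxE -/F deriveE.
have := @diff_derivable _ _ _ F y d dg; rewrite /derivable => /cvgrPdist_le.
rewrite -/(derive F y d) dE => /(_ e e0).
rewrite near_withinE => /nbhs_dist[r r0 rP]; exists r => // t tr.
have [->|t0] := eqVneq t 0.
  by rewrite scale0r addr0 subrr mul0r subrr normr0 mulr0.
have := rP t; rewrite subr0 => /(_ tr t0) /=.
rewrite -/F (addrC y) => H.
have -> : F (t *: d + y) - F y - t * dot (gradient g y) d =
  - (t * (dot (gradient g y) d - t^-1 * (F (t *: d + y) - F y))).
  by rewrite mulrBr mulrA mulfV// mul1r opprB.
by rewrite normrN normrM mulrC ler_wpM2r.
Qed.

Lemma lsc_on_near {R : realType} {n : nat} (A : set 'rV[R]_n)
    (g : 'rV[R]_n -> \bar R) (x : 'rV[R]_n) (a : R) : lsc_on A g -> A x ->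
  (a%:E < g x)%E -> \forall y \near x, A y -> (a%:E < g y)%E.
Proof.
move=> glsc Ax /glsc[U + Ua]; rewrite {1}/nbhs/= -nbhs_subspace_in// => xU.
have {}xU : nbhs x [set y | A y -> U y] := xU.
by apply: filterS xU => y /= AU Ay; exact: (Ua y (AU Ay)).
Qed.

Lemma econvex_le {R : realType} {n : nat} (g : 'rV[R]_n -> \bar R)
    (x y : 'rV[R]_n) (t a b : R) : econvex_on setT g ->
    g x = a%:E -> g y = b%:E -> (0 <= t <= 1)%R ->
  (g (x + t *: (y - x))%R <= ((1 - t) * a + t * b)%:E)%E.
Proof.
move=> cvx xa yb /andP[]; rewrite le_eqVlt => /predU1P[<- _|t0].
  by rewrite scale0r addr0 subr0 mul1r mul0r addr0 xa.
rewrite le_eqVlt => /predU1P[->|t1].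
  by rewrite scale1r addrC subrK subrr mul0r mul1r add0r yb.
have := cvx y x t I I; rewrite t0 t1 xa yb.
move=> /(_ isT); rewrite -!EFinM -EFinD (addrC (t * b)%R).
suff -> : (x + t *: (y - x) = t *: y + (1 - t) *: x)%R by [].
by apply/rowP => i; rewrite !mxE; ring.
Qed.

Section dgf.
Local Open Scope ereal_scope.
Context {R : realType} {n : nat}.
Local Notation V := 'rV[R]_n.
Variable phi : V -> \bar R.
Local Notation X := (edom phi).
Local Notation Y := ((edom phi)°).
Local Notation grad := (gradient phi).
Implicit Types (u v w x y z p d : V).
Hypothesis phi_dgf : is_dgf phi.

Lemma dgf_gtNy x : -oo < phi x.
Proof. by case: phi_dgf => -[_ /(_ x I)]; rewrite ltNye. Qed.

Lemma dgf_lsc : lower_semicontinuous phi.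
Proof.
case: phi_dgf => _ lsc _ _ _ x a ax.
by exists [set y | setT y -> a%:E < phi y]; [exact: lsc_on_near|by move=> y; apply].
Qed.

Lemma dgf_fin x : X x -> exists a : R, phi x = a%:E.
Proof.
rewrite /edom /=; have := dgf_gtNy x; case: (phi x) => // a _ _; by exists a.
Qed.

Lemma dgf_edom x (a : R) : phi x <= a%:E -> X x.
Proof. by move=> /le_lt_trans; apply; rewrite ltry. Qed.

Lemma dgf_conv x y (t a b : R) : phi x = a%:E -> phi y = b%:E ->
  (0 <= t <= 1)%R -> phi (x + t *: (y - x)) <= ((1 - t) * a + t * b)%:E.
Proof. by case: phi_dgf => _ _ cvx _ _; exact: econvex_le. Qed.

Lemma dgf_int x : Y x -> X x.
Proof. exact: interior_subset. Qed.

Lemma dgf_int_ball x : Y x -> exists2 r : R, (0 < r)%R &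
  forall y, (`|y - x| < r)%R -> X y.
Proof. exact: nbhs_dist. Qed.

(** A small ball around the point of the segment is the image of a small ball
    around [x] under the homothety of centre [z]. *)
Lemma dgf_segment x z (s : R) : Y x -> X z -> (0 <= s < 1)%R ->
  Y (x + s *: (z - x))%R.
Proof.
move=> /dgf_int_ball[r r0 rP] /dgf_fin[b zb] /andP[s0 s1].
have s1' : (0 < 1 - s)%R by rewrite subr_gt0.
apply: filterS (near_dist (x + s *: (z - x))%R (mulr_gt0 s1' r0)) => y yr.
pose d := ((1 - s)^-1 *: (y - (x + s *: (z - x))))%R.
have Xd : X (x + d)%R.
  apply: rP; rewrite addrC addKr normrZ gtr0_norm ?invr_gt0//.
  by rewrite mulrC ltr_pdivrMr// mulrC.
have [a da] := dgf_fin Xd.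
have -> : y = (x + d + s *: (z - (x + d)))%R.
  by apply/rowP => i; rewrite !mxE; field; rewrite gt_eqF.
apply: dgf_edom (dgf_conv da zb _).
by rewrite s0 ltW.
Qed.

Lemma dgf_cont y (e : R) : Y y -> (0 < e)%R ->
  \forall z \near y, (`|fine (phi z) - fine (phi y)| < e)%R.
Proof.
case: phi_dgf => _ _ _ _ dphi /dphi/differentiable_continuous/cvgrPdist_lt cy e0.
by apply: filterS (cy e e0) => z; rewrite /= distrC.
Qed.

Lemma gradient_subdiff y : Y y -> subdifferential phi y (grad y).
Proof.
move=> Yy z; have [a ya] := dgf_fin (dgf_int Yy).
have := dgf_gtNy z; case zb : (phi z) => [b| |] // _; last by rewrite leey.
rewrite ya -EFinD lee_fin; apply/ler_addgt0Pr => e e0.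
case: phi_dgf => _ _ _ _ /(_ _ Yy) dphi.
have [r r0 rP] := gradient_cvg (z - y)%R dphi e0.
pose t := (Num.min 1 (r / 2))%R.
have t0 : (0 < t)%R by rewrite lt_min ltr01 divr_gt0.
have t1 : (t <= 1)%R by rewrite ge_min lexx.
have tr : (t < r)%R by apply: (@le_lt_trans _ _ (r / 2)%R); [rewrite ge_min lexx orbT|lra].
have T01 : (0 <= t <= 1)%R by rewrite t1 ltW.
have := rP t; rewrite gtr0_norm// => /(_ tr).
have := dgf_conv ya zb T01; have /dgf_fin[c ->] := dgf_edom (dgf_conv ya zb T01).
rewrite ya /= lee_fin ler_norml => H /andP[H1 _].
by rewrite -(ler_pM2l t0); lra.
Qed.

(** The subgradient inequality bounds the derivative in the directions [d] and
    [- d]. *)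
Lemma subdiff_gradient y v : Y y -> subdifferential phi y v -> v = grad y.
Proof.
move=> Yy yv; apply: dot_inj => d; apply/eqP; rewrite -subr_eq0 -dotBl.
set q := dot _ d; have [a ya] := dgf_fin (dgf_int Yy).
apply: contraT => q0; have e0 : (0 < `|q| / 2)%R by rewrite divr_gt0 ?normr_gt0.
case: phi_dgf => _ _ _ _ /(_ _ Yy) dphi.
have [r r0 rP] := gradient_cvg d dphi e0.
have [s s0 sP] := dgf_int_ball Yy.
have d1 : (0 < `|d| + 1)%R by rewrite ltr_wpDl.
pose t := (Num.min (r / 2) (s / 2 / (`|d| + 1)))%R.
have t0 : (0 < t)%R by rewrite lt_min !divr_gt0.
have tr : (t < r)%R by apply: (@le_lt_trans _ _ (r / 2)%R); [rewrite ge_min lexx|lra].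
have ts : (t * (`|d| + 1) < s)%R.
  apply: (@le_lt_trans _ _ (s / 2)%R); last by lra.
  by rewrite -ler_pdivlMr// ge_min lexx orbT.
(* The subgradient inequality is tested in the direction in which q is positive. *)
have key t' : (`|t'| = t)%R -> (0 <= t' * q)%R -> False.
  move=> tt tq; have Xt : X (y + t' *: d)%R.
    apply: sP; rewrite addrC addKr normrZ tt; apply: le_lt_trans ts.
    by rewrite ler_pM2l// lerDl.
  have [b tb] := dgf_fin Xt; have := rP t'; rewrite tt ya tb => /(_ tr) /=.
  rewrite ler_norml => /andP[_]; have := subdiff_le yv ya tb.
  rewrite [(y + _)%R]addrC addrK dotZr => H1 H2.
  have : (t' * q = `|q| * t)%R by rewrite -tt mulrC -normrM ger0_norm// mulrC.
  rewrite /q dotBl => H3; have : (0 < `|q| * t)%R by rewrite mulr_gt0// normr_gt0.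
  rewrite /q dotBl in H2 *; lra.
have [q1|q1] := leP 0%R q.
  by case: (key t); rewrite ?gtr0_norm// mulr_ge0// ltW.
case: (key (- t)%R); rewrite ?normrN ?gtr0_norm//.
by rewrite mulNr -mulrN mulr_ge0 ?(ltW t0)// oppr_ge0 ltW.
Qed.

End dgf.

(** * Legendre functions *)

Section legendre.
Local Open Scope ereal_scope.
Context {R : realType} {n : nat}.
Local Notation V := 'rV[R]_n.
Variable phi : V -> \bar R.
Local Notation X := (edom phi).
Local Notation Y := ((edom phi)°).
Local Notation grad := (gradient phi).
Implicit Types (u v w x y z p d : V).
Hypotheses (phi_dgf : is_dgf phi) (phi_legendre : legendre phi)
  (phi_coercive : one_coercive phi).

Lemma dgf_int_convex : convex_set (Y : set (convex_lmodType V)).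
Proof.
apply/convex_setW => x y xY yY k k0 k1; rewrite !inE in xY yY *.
have K : (0 <= 1 - k%:num < 1)%R by rewrite subr_ge0 ltW//= ltrBlDr ltrDl.
have := dgf_segment phi_dgf xY (dgf_int yY) K.
suff -> : (x + (1 - k%:num) *: (y - x) = k%:num *: x + (1 - k%:num) *: y)%R by [].
by apply/rowP => i; rewrite !mxE; ring.
Qed.

(** Compare the value at the midpoint, strictly below the average, with the
    tangents at the two ends. *)
Lemma gradient_strict_mono x y : Y x -> Y y -> x <> y ->
  (0 < dot (grad x - grad y) (x - y))%R.
Proof.
move=> Yx Yy /eqP xy.
have sub : Y `<=` [set x | subdifferential phi x !=set0].
  by move=> z Yz; exists (grad z); exact: gradient_subdiff.
have [_ esc] := phi_legendre.
have h01 : (0 < (2^-1 : R) < 1)%R by apply/andP; split; lra.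
have := esc _ dgf_int_convex sub x y 2^-1%R Yx Yy xy h01.
have [a xa] := dgf_fin phi_dgf (dgf_int Yx).
have [b yb] := dgf_fin phi_dgf (dgf_int Yy).
set m := (_ + _)%R; rewrite xa yb -!EFinM -EFinD => mlt.
have [c mc] := dgf_fin phi_dgf (dgf_edom (ltW mlt)).
have := subdiff_le (gradient_subdiff phi_dgf Yx) xa mc.
have := subdiff_le (gradient_subdiff phi_dgf Yy) yb mc.
by move: mlt; rewrite mc lte_fin /m !dotE; lra.
Qed.

(** 1-coercivity controls [phi] far away, an affine minorant near the origin. *)
Lemma dgf_supercoercive : supercoercive phi.
Proof.
have [[y0 Yy0] _ _] := phi_legendre.1.
have [a ya] := dgf_fin phi_dgf (dgf_int Yy0).
pose S := norm1 (grad y0); have S0 : (0 <= S)%R := norm1_ge0 _.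
pose c := (`|a| + S * `|y0|)%R.
have affine x : (- c - S * `|x|)%:E <= phi x.
  have := gradient_subdiff phi_dgf Yy0 x; rewrite ya; apply: le_trans.
  rewrite -EFinD lee_fin; have := dot_le_norm (grad y0) (x - y0)%R.
  rewrite ler_norml -/S => /andP[+ _]; have := ler_wpM2l S0 (ler_normB x y0).
  by rewrite /c; have := ler_norm (- a)%R; rewrite normrN; lra.
move=> M; set M' := `|M|%R.
have supy := phi_coercive; rewrite /one_coercive limf_einfE in supy.
have M'y : M'%:E < +oo by rewrite ltry.
rewrite -supy in M'y; have [_ [U [r _ rU] <-] MU] := ereal_sup_gt M'y.
set r' := (Num.max r 1)%R.
exists (M' * r' + c + S * r')%R => x.
have r'1 : (1 <= r')%R by rewrite le_max lexx orbT.
have M0 : (0 <= M')%R by exact: normr_ge0.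
have c0 : (0 <= c)%R by rewrite addr_ge0// mulr_ge0.
have Mx : (M * `|x| <= M' * `|x|)%R by rewrite ler_wpM2r// ler_norm.
have [xr|rx] := leP (l2norm x) r'.
  apply: le_trans (affine x); rewrite lee_fin.
  have := ler_wpM2l M0 (le_trans (norm_le_l2norm x) xr).
  have := ler_wpM2l S0 (le_trans (norm_le_l2norm x) xr); lra.
have x0 : (0 < l2norm x)%R by apply: lt_trans rx; apply: lt_le_trans r'1.
have : M'%:E < phi x * ((l2norm x)^-1)%:E.
  apply: (lt_le_trans MU); apply: ereal_inf_lbound; exists x => //.
  by apply: rU => /=; apply: le_lt_trans rx; rewrite le_max lexx.
rewrite lte_pdivlMr// => /ltW; apply: le_trans; rewrite -EFinM lee_fin.
have := ler_wpM2l M0 (norm_le_l2norm x).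
have : (0 <= M' * r' + S * r')%R by rewrite addr_ge0// mulr_ge0//; lra.
lra.
Qed.

Lemma l2norm_le u (B : R) : (0 <= B)%R -> (forall i, `|u ord0 i| <= B)%R ->
  (l2norm u <= Num.sqrt (n%:R * B ^+ 2))%R.
Proof.
move=> B0 uB; have -> : (n%:R * B ^+ 2 = \sum_(i < n) B ^+ 2)%R.
  by rewrite sumr_const card_ord mulr_natl.
rewrite ler_wsqrtr// /dot; apply: ler_sum => i _.
rewrite -expr2 -real_normK ?num_real// ler_pXn2r ?nnegrE//.
Qed.

(** Were there a subgradient [v] at a boundary point [y], the gradients along the
    segment from an interior point [y0] to [y] would stay bounded, against
    essential smoothness: monotonicity with respect to [v] bounds them below in the
    direction [y0 - y], so the tangents tested at the points of a ball around [y0],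
    on which [phi] is bounded above, bound them in every direction. *)
Lemma subdiff_int y v : subdifferential phi y v -> Y y.
Proof.
move=> yv; apply: contrapT => nYy.
have [[y0 Yy0] _ ess] := phi_legendre.1.
have [a0 ya0] := dgf_fin phi_dgf (dgf_int Yy0).
have [a ya] := subdiff_fin dgf_supercoercive (dgf_int Yy0) yv.
have Xy : X y by apply: (@dgf_edom _ _ phi y a); rewrite ya.
have [s s0 sP] := dgf_int_ball Yy0.
have [r r0 rP] := nbhs_dist (dgf_cont phi_dgf Yy0 ltr01).
pose q := (Num.min s r / 2)%R.
have q0 : (0 < q)%R by rewrite divr_gt0// lt_min s0.
have qsr : ((q < s) /\ (q < r))%R.
  have : (0 < Num.min s r)%R by rewrite lt_min s0.
  have : (Num.min s r <= s)%R by rewrite ge_min lexx.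
  have : (Num.min s r <= r)%R by rewrite ge_min lexx orbT.
  by rewrite /q; split; lra.
pose u t := (y0 + t *: (y - y0))%R.
have Yu t : (0 <= t < 1)%R -> Y (u t) by exact: dgf_segment.
pose B := (`|(a0 + 1 - a - dot v (y0 - y)) / q|)%R.
have gradB t : (0 <= t < 1)%R -> (l2norm (grad (u t)) <= Num.sqrt (n%:R * B ^+ 2))%R.
  move=> t01; apply: l2norm_le => [|i]; first exact: normr_ge0.
  have /andP[t0 t1] := t01.
  set G := grad (u t).
  have Gu := gradient_subdiff phi_dgf (Yu _ t01); rewrite -/G in Gu.
  have [b ub] := dgf_fin phi_dgf (dgf_int (Yu _ t01)).
  have E (s' : R) : (`|s'| = 1)%R -> (s' * G ord0 i <= B)%R.
    move=> s'1; pose d := ((q * s') *: delta_mx ord0 i : V)%R.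
    have dq : (`|d| <= q)%R.
      rewrite normrZ normrM s'1 mulr1 gtr0_norm// ler_piMr ?(ltW q0)//.
      by apply: norm_leP => // j; rewrite mxE eqxx; case: (j == i); rewrite ?normr1 ?normr0.
    have d1 : (`|y0 + d - y0| <= q)%R by rewrite addrC addKr.
    have [c dc] := dgf_fin phi_dgf (sP _ (le_lt_trans d1 qsr.1)).
    have := rP _ (le_lt_trans d1 qsr.2); rewrite dc ya0 /= ltr_norml => /andP[_ c1].
    have H1 := subdiff_le Gu ub dc.
    have H2 := subdiff_le Gu ub ya.
    have H3 := subdiff_le yv ya ub.
    have dG : dot G d = (q * (s' * G ord0 i))%R by rewrite dotZr dot_delta mulrA.
    have : (q * (s' * G ord0 i) <= a0 + 1 - a - dot v (y0 - y))%R.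
      have t1' : (0 < 1 - t)%R by rewrite subr_gt0.
      have H4 : (dot v (y0 - y) <= dot G (y0 - y))%R.
        by rewrite -(ler_pM2l t1'); move: H2 H3; rewrite /u !dotE; lra.
      have := ler_wpM2l t0 H4.
      rewrite -dG; move: H1 H3; rewrite /u !dotE in H4 *; lra.
    rewrite mulrC -ler_pdivlMr// => /le_trans; apply; exact: ler_norm.
  rewrite ler_norml; have := E 1%R (normr1 _); have := E (-1)%R (normrN1 _).
  by rewrite mul1r mulN1r; lra.
have cvgu : u (1 - k.+1%:R^-1)%R @[k --> \oo] --> y.
  apply/cvgrPdist_lt => e e0.
  have E0 : (0 < e / (`|y - y0| + 1))%R by rewrite divr_gt0// ltr_wpDl.
  apply: filterS (near_infty_natSinv_lt (PosNum E0)) => k /=.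
  rewrite ltr_pdivlMr ?ltr_wpDl// => ke.
  have -> : (y - u (1 - k.+1%:R^-1) = k.+1%:R^-1 *: (y - y0))%R.
    by apply/rowP => i; rewrite !mxE; ring.
  rewrite normrZ ger0_norm ?invr_ge0//; apply: le_lt_trans ke.
  by rewrite ler_wpM2l ?invr_ge0// lerDl.
have k01 k : (0 <= (1 - k.+1%:R^-1 : R) < 1)%R.
  by rewrite subr_ge0 invf_le1// ler1n/= ltrBlDr ltrDl invr_gt0.
have := ess _ y (fun k => Yu _ (k01 k)) _ cvgu => /(_ _)/wrap[|].
  by split => //; exact: subset_closure.
move=> /cvgryPgt/(_ (Num.sqrt (n%:R * B ^+ 2))) [N _ /(_ N (leqnn N))] /=.
by rewrite ltNge gradB.
Qed.

Lemma gradient_inj x y : Y x -> Y y -> grad x = grad y -> x = y.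
Proof.
move=> Yx Yy xy; apply: contrapT => /(gradient_strict_mono Yx Yy).
by rewrite xy subrr dot0l ltxx.
Qed.

Lemma subdiff_gradientE y v : subdifferential phi y v -> Y y /\ grad y = v.
Proof.
by move=> yv; have Yy := subdiff_int yv; split=> //; rewrite (subdiff_gradient phi_dgf Yy yv).
Qed.

(** Minimizers of the tilts of [phi] are interior, by [subdiff_int]. *)
Lemma gradient_surj v : exists2 y, Y y & grad y = v.
Proof.
have [[y0 Yy0] _ _] := phi_legendre.1.
have [y yv] := subdiff_exists (dgf_lsc phi_dgf) dgf_supercoercive (dgf_int Yy0) v.
by have [Yy <-] := subdiff_gradientE yv; exists y.
Qed.

Lemma conjugateE y v (a : R) : subdifferential phi y v -> phi y = a%:E ->
  conjugate phi v = (dot v y - a)%:E.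
Proof.
move=> yv ya; apply/eqP; rewrite eq_le; apply/andP; split.
  apply: ge_ereal_sup => _ [x _ <-].
  have := dgf_gtNy phi_dgf x; case xb : (phi x) => [b| |] // _; last by rewrite addeNy leNye.
  have := subdiff_le yv ya xb; rewrite -EFinD lee_fin !dotE; lra.
by apply: ereal_sup_ubound; exists y => //; rewrite ya.
Qed.

(** A difference of values of the conjugate in direction [h e_i] lies between
    [h y_i] and [h z_i], where [z] has gradient [grad y + h e_i]; and [z] tends to [y]
    by [subdiff_stable]. *)
Lemma gradient_conjugate y : Y y -> gradient (conjugate phi) (grad y) = y.
Proof.
move=> Yy; have yv := gradient_subdiff phi_dgf Yy.
have [a ya] := dgf_fin phi_dgf (dgf_int Yy).
have uniq_y x : subdifferential phi x (grad y) -> x = y.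
  by move=> /subdiff_gradientE[Yx xy]; exact: gradient_inj.
have stab := subdiff_stable (dgf_lsc phi_dgf) dgf_supercoercive (dgf_int Yy) yv uniq_y.
apply/rowP => i; rewrite mxE /derive; apply: cvg_lim => //.
apply/cvgrPdist_lt => e e0; have [d d0 dP] := stab e e0.
rewrite near_withinE; apply: filterS (near_dist 0%R d0) => h.
rewrite subr0 => hd h0 /=.
set v := (h *: delta_mx ord0 i + grad y)%R; have [z Yz zv] := gradient_surj v.
have zsub := gradient_subdiff phi_dgf Yz; rewrite zv in zsub.
have [b zb] := dgf_fin phi_dgf (dgf_int Yz).
have := dP v z; rewrite {1}/v addrK => /(_ _ zsub)/wrap[|zy].
  rewrite normrZ; apply: le_lt_trans hd; rewrite ler_piMr//.
  by apply: norm_leP => // j; rewrite mxE eqxx; case: (j == i); rewrite ?normr1 ?normr0.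
rewrite (conjugateE zsub zb) (conjugateE yv ya) /=.
have H1 := subdiff_le zsub zb ya; have H2 := subdiff_le yv ya zb.
move: H1 H2; rewrite /v !dotE ![dot (delta_mx _ _) _]dotC !dot_delta => H1 H2.
have zyi := le_lt_trans (norm_coord (z - y)%R i) zy; rewrite !mxE in zyi.
apply: le_lt_trans zyi.
set D := (_ - _ - _)%R.
have -> : (y ord0 i - h^-1 *: D = h^-1 * (h * y ord0 i - D))%R.
  by rewrite mulrBr mulrA mulVf// mul1r.
have h1 : (0 < `|h|)%R by rewrite normr_gt0.
rewrite normrM normfV ler_pdivrMl// -normrM ler_norml.
have := ler_norm (h * (z ord0 i - y ord0 i))%R; rewrite /D.
have := normr_ge0 (h * (z ord0 i - y ord0 i))%R; lra.
Qed.

End legendre.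

(** * Convexity relative to a Legendre function *)

(** Monotonicity of the operator [subdifferential g - gradient phi]. *)
Definition rel_monotone {R : realType} {n : nat} (phi g : 'rV[R]_n -> \bar R) :=
  forall x y u v : 'rV[R]_n, subdifferential g x u -> subdifferential g y v ->
  dot (x - y) (gradient phi x - gradient phi y) <= dot (x - y) (u - v).

Section relative_convexity.
Local Open Scope ereal_scope.
Context {R : realType} {n : nat}.
Local Notation V := 'rV[R]_n.
Variables (phi g : V -> \bar R) (x0 : V).
Local Notation X := (edom phi).
Local Notation Y := ((edom phi)°).
Local Notation grad := (gradient phi).
Implicit Types (u v w x y z p d : V).
Hypotheses (phi_dgf : is_dgf phi) (phi_legendre : legendre phi).
Hypotheses (glsc : lower_semicontinuous g) (gsc : supercoercive g)
  (gx0 : g x0 < +oo).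
Hypothesis g_dom : forall x, g x < +oo -> X x.
Hypothesis g_int : forall x v, subdifferential g x v -> Y x.
Hypothesis g_mono : rel_monotone phi g.

(** Equal subgradients at [x] and [y] contradict strict monotonicity of [grad]
    unless [x = y]. *)
Lemma rel_monotone_inj v x y :
  subdifferential g x v -> subdifferential g y v -> x = y.
Proof.
move=> xv yv; apply: contrapT.
move=> /(gradient_strict_mono phi_dgf phi_legendre (g_int xv) (g_int yv)).
by have := g_mono xv yv; rewrite subrr dot0r dotC; lra.
Qed.

Let g_cvx := supercoercive_econvex glsc gsc gx0 rel_monotone_inj.

Definition seg x z (r : R) : V := (x + r *: (z - x))%R.

Lemma segment_fin x z (A B s : R) : g x = A%:E -> g z = B%:E ->
  (0 <= s <= 1)%R -> g (x + s *: (z - x)) = (fine (g (x + s *: (z - x))))%:E.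
Proof.
move=> gx gz s01; have := econvex_le g_cvx gx gz s01.
by have := supercoercive_gtNy (x + s *: (z - x))%R gsc; case: (g _).
Qed.

(** The slope of [g] on [[s, s + h]] against that of [phi] on [[s - h, s]], along
    the segment from [x] to [z].  Let [w] be the point at [s], [y] a resolvent point
    near [w], and [u = k (w - y)].  Because [<u, y - w> <= 0], relative monotonicity
    between [y] and [x] gives [s <u, z - x> >= <grad y + v - grad x, y - x>], while the
    subgradient [u] tested at [s + h] bounds the increment of [g] below by
    [h <u, z - x>].  The tangent of [phi] at [y], tested at the point moved back
    towards [x] by the ratio [h / s], turns [<grad y, y - x>] into a difference of
    values of [phi], which has a limit as [y] tends to [w]. *)
Lemma slope_step x v z (B s h : R) : subdifferential g x v -> g z = B%:E ->
  (0 < h)%R -> (h <= s)%R -> (s + h <= 1)%R ->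
  (fine (phi (seg x z s)) - fine (phi (seg x z (s - h)))
     + h * dot (v - grad x) (z - x) <=
   fine (g (seg x z (s + h))) - fine (g (seg x z s)))%R.
Proof.
move=> xv gz h0 hs sh1; pose w r := (x + r *: (z - x))%R.
rewrite -[seg x z s]/(w s) -[seg _ _ (s - h)]/(w (s - h)%R).
rewrite -[seg _ _ (s + h)]/(w (s + h)%R).
have s0 : (0 < s)%R by exact: lt_le_trans hs.
have [A gx] := subdiff_fin gsc gx0 xv.
have Xz : X z by apply: g_dom; rewrite gz ltry.
have gs : g (w s) = (fine (g (w s)))%:E by apply: (segment_fin gx gz); lra.
have gsh : g (w (s + h)%R) = (fine (g (w (s + h)%R)))%:E.
  by apply: (segment_fin gx gz); lra.
have Ys : Y (w s) by apply: dgf_segment => //; [exact: g_int xv|lra].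
have Ysh : Y (w (s - h)%R) by apply: dgf_segment => //; [exact: g_int xv|lra].
set c := (v - grad x)%R.
have [x_ sub] := subdiff_resolvent_seq glsc gsc gx0 rel_monotone_inj (w s).
have [|xw _] := subdiff_penalty glsc gsc gx0 (B := fine (g (w s))) sub.
  move=> k; have [a ga] := subdiff_fin gsc gx0 (sub k).
  by have := subdiff_le (sub k) ga gs; rewrite ga -EFinD lee_fin dotZl.
set rho := (h / s)%R.
have rho01 : (0 <= rho <= 1)%R by rewrite divr_ge0 ?(ltW h0) ?(ltW s0)//= ler_pdivrMr// mul1r.
have rhos : (rho * s = h)%R by rewrite divfK// gt_eqF.
apply/ler_addgt0Pr => e e0; have e40 : (0 < e / 4)%R by rewrite divr_gt0.
(* Along the resolvent points, every term is eventually within e/4 of its limit. *)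
have near1 : \forall y \near w s, (fine (g (w s)) - e / 4)%:E < g y.
  by apply: lsc_near => //; rewrite gs lte_fin; lra.
have near2 := dgf_cont phi_dgf Ys e40.
have near3 := near_dot c (w s) e40.
have near4 : \forall y \near w s, X (y - rho *: (y - x))%R /\
    (`|fine (phi (y - rho *: (y - x))) - fine (phi (w (s - h)))| < e / 4)%R.
  have [r r0 rP] := nbhs_dist (filterI Ysh (dgf_cont phi_dgf Ysh e40)).
  apply: filterS (near_dist (w s) r0) => y yr; apply: rP; apply: le_lt_trans yr.
  have -> : (y - rho *: (y - x) - w (s - h) = (1 - rho) *: (y - w s))%R.
    by apply/rowP => i; rewrite -rhos !mxE; ring.
  by rewrite normrZ ler_piMl// ger0_norm; lra.
have near_k P : nbhs (w s) P -> \forall k \near \oo, P (x_ k) by exact: xw.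
have [k [[/= N1 N2] [/= N3 [Xp N4]]]] := filter_ex
  (filterI (filterI (near_k _ near1) (near_k _ near2))
           (filterI (near_k _ near3) (near_k _ near4))).
have Yk := g_int (sub k).
move: (sub k) Yk N1 N2 N3 Xp N4; set K := (k.+1%:R : R); set y := x_ k.
have [u uE] : exists u, u = (K *: (w s - y))%R by eexists.
rewrite -uE => yu Yk + N2 N3 Xp N4.
have [Gy gy] := subdiff_fin gsc gx0 yu; rewrite gy lte_fin => N1.
have [b0 yb] := dgf_fin phi_dgf (dgf_int Yk).
have [b1 pb] := dgf_fin phi_dgf Xp.
have H1 := g_mono yu xv.
have H2 := subdiff_le yu gy gsh.
have H3 := subdiff_le (gradient_subdiff phi_dgf Yk) yb pb.
have H4 : (dot u (y - w s) <= 0)%R.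
  rewrite uE dotZl -[(y - w s)%R]opprB dotNr mulrN oppr_le0 mulr_ge0 ?ler0n//.
  exact: dotxx_ge0.
have E1 : (dot u (w (s + h) - y) = h * dot u (z - x) - dot u (y - w s))%R.
  by rewrite /w !dotE; ring.
have E2 : (dot u (y - x) = s * dot u (z - x) + dot u (y - w s))%R.
  by rewrite /w !dotE; ring.
have E3 : (rho * dot c (y - x) = rho * dot c (y - w s) + h * dot c (z - x))%R.
  by rewrite -rhos /w !dotE; ring.
have E4 : (dot (grad y) (y - rho *: (y - x) - y) = - (rho * dot (grad y) (y - x)))%R.
  by rewrite !dotE; ring.
have H5 : (dot (grad y) (y - x) + dot c (y - x) <= s * dot u (z - x))%R.
  by move: H1 E2 H4; rewrite /c !(dotC (y - x)%R) !(dotBl _ _ (y - x)%R); lra.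
have H6 := ler_wpM2l (proj1 (andP rho01)) H5.
rewrite mulrDr mulrA rhos in H6.
move: N2 N3 N4; rewrite yb pb /= !ltr_norml => /andP[N2 _] /andP[N3 _] /andP[_ N4].
have N5 : (- (e / 4) <= rho * dot c (y - w s))%R.
  by case/andP: rho01 => r0 r1; nra.
rewrite E1 in H2; rewrite E4 in H3; rewrite E3 in H6; rewrite gs gsh /=.
lra.
Qed.

(** Sum [slope_step] over a uniform subdivision: the sums telescope up to a shift
    by one step at both ends.  At [x] the subgradient [v] absorbs the shift, at
    [z] lower semicontinuity of [phi] does. *)
Lemma rel_strong_subdiff x v z (A B a b : R) : subdifferential g x v ->
  g x = A%:E -> g z = B%:E -> phi x = a%:E -> phi z = b%:E ->
  (A + dot v (z - x) + (b - a - dot (grad x) (z - x)) <= B)%R.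
Proof.
move=> xv gx gz xa zb; pose w r := (x + r *: (z - x))%R.
have Xz : X z by apply: g_dom; rewrite gz ltry.
have Yx := g_int xv.
have w0 : w 0%R = x by rewrite /w scale0r addr0.
have w1 : w 1%R = z by rewrite /w scale1r addrC subrK.
set C := dot (v - grad x)%R (z - x)%R; pose D := (B - A - C)%R.
set Q := dot (grad x) (z - x)%R.
have tele k : phi (w (1 - k.+1%:R^-1)%R) <= (a + D - k.+1%:R^-1 * Q)%:E.
  set h := (k.+1%:R^-1 : R)%R.
  have h0 : (0 < h)%R by rewrite invr_gt0.
  have kh : (k.+1%:R * h = 1)%R by rewrite mulfV.
  have h1 : (h <= 1)%R by rewrite invf_le1// ler1n.
  have sum i : (i <= k)%N -> (fine (phi (w (i%:R * h))) - a + i%:R * h * C <=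
      fine (g (w (i.+1%:R * h))) - fine (g (w h)))%R.
    elim: i => [_|i IH ik]; first by rewrite mul1r mul0r w0 xa /= !subrr mul0r addr0.
    have := IH (ltnW ik).
    have ikh : (i.+1%:R * h + h <= 1)%R.
      have -> : (i.+1%:R * h + h = i.+2%:R * h)%R by rewrite -[i.+2%:R]natr1; ring.
      by rewrite -[leRHS]kh ler_pM2r// ler_nat.
    have hi : (h <= i.+1%:R * h)%R by rewrite ler_peMl ?(ltW h0)// ler1n.
    have := slope_step xv gz h0 hi ikh; rewrite -/C -![seg x z _]/(w _).
    have -> : (i.+1%:R * h - h = i%:R * h)%R by rewrite -natr1; ring.
    have -> : (i.+1%:R * h + h = i.+2%:R * h)%R by rewrite -[i.+2%:R]natr1; ring.
    by rewrite -[i.+1%:R]natr1; rewrite /w; lra.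
  have := sum k (leqnn k); rewrite kh w1 gz /=.
  have -> : (k%:R * h = 1 - h)%R by move: kh; rewrite -natr1 mulrDl mul1r; lra.
  have h01 : (0 <= h <= 1)%R by rewrite h1 ltW.
  have := subdiff_le xv gx (segment_fin gx gz h01).
  have -> : (x + h *: (z - x) - x = h *: (z - x))%R by rewrite addrC addKr.
  rewrite -[(x + h *: _)%R]/(w h) dotZr.
  have Yh : Y (w (1 - h)%R) by apply: dgf_segment => //; lra.
  have [b' ->] := dgf_fin phi_dgf (dgf_int Yh).
  by rewrite lee_fin /= -/(w h) /D /C dotBl /Q; lra.
suff : (b <= a + D)%R by rewrite /D /C dotBl /Q; lra.
apply/ler_addgt0Pr => e e0; rewrite -lee_fin -zb.
have D1 : (0 < `|Q| + `|z - x| + 1)%R by rewrite ltr_wpDl// addr_ge0.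
have cvgw : w (1 - k.+1%:R^-1)%R @[k --> \oo] --> z.
  apply/cvgrPdist_lt => r r0.
  have E0 : (0 < r / (`|Q| + `|z - x| + 1))%R by rewrite divr_gt0.
  apply: filterS (near_infty_natSinv_lt (PosNum E0)) => k /=.
  rewrite ltr_pdivlMr// => ke.
  have -> : (z - w (1 - k.+1%:R^-1) = k.+1%:R^-1 *: (z - x))%R.
    by apply/rowP => i; rewrite !mxE; ring.
  rewrite normrZ ger0_norm ?invr_ge0//; apply: le_lt_trans ke.
  by rewrite ler_wpM2l ?invr_ge0//; have := normr_ge0 Q; lra.
apply: (lsc_cvg_le (dgf_lsc phi_dgf) cvgw).
have E0 : (0 < e / (`|Q| + `|z - x| + 1))%R by rewrite divr_gt0.
apply: filterS (near_infty_natSinv_lt (PosNum E0)) => k /=.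
rewrite ltr_pdivlMr// => ke; apply: le_trans (tele k) _; rewrite lee_fin.
have r0 : (0 < k.+1%:R^-1 :> R)%R by rewrite invr_gt0.
move: (k.+1%:R^-1 : R)%R ke r0 => r ke r0.
have Qn : (- Q <= `|Q|)%R by rewrite -normrN ler_norm.
have := ler_wpM2l (ltW r0) Qn; have := mulr_ge0 (ltW r0) (normr_ge0 (z - x)%R).
lra.
Qed.

(** The strengthened inequalities at the resolvent points [x_k] of [m], tested at
    [x] and [y], with the tangent of [phi] at [x_k] tested at [m]. *)
Lemma rel_convex x y (t A B a b c : R) : (0 < t < 1)%R ->
  g x = A%:E -> g y = B%:E -> phi x = a%:E -> phi y = b%:E ->
  let m := (t *: x + (1 - t) *: y)%R in phi m = c%:E ->
  g m <= (t * (A - a) + (1 - t) * (B - b) + c)%:E.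
Proof.
move=> /andP[t0 t1] gx gy xa yb m mc.
have t1' : (0 < 1 - t)%R by rewrite subr_gt0.
have [x_ sub] := subdiff_resolvent_seq glsc gsc gx0 rel_monotone_inj m.
have [|//] := subdiff_penalty glsc gsc gx0
  (B := (t * (A - a) + (1 - t) * (B - b) + c)%R) sub.
move=> k; have [G gk] := subdiff_fin gsc gx0 (sub k).
have Yk := g_int (sub k); have [p kp] := dgf_fin phi_dgf (dgf_int Yk).
have := ler_wpM2l (ltW t0) (rel_strong_subdiff (sub k) gk gx kp xa).
have := ler_wpM2l (ltW t1') (rel_strong_subdiff (sub k) gk gy kp yb).
have := subdiff_le (gradient_subdiff phi_dgf Yk) kp mc.
rewrite gk -EFinD lee_fin.
have E z y' : dot z (m - y') = (t * dot z (x - y') + (1 - t) * dot z (y - y'))%R.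
  by rewrite /m !dotE; ring.
by rewrite !E !dotZl; lra.
Qed.

End relative_convexity.

(** * The function phi + lambda f *)

Section regularized_sum.
Local Open Scope ereal_scope.
Context {R : realType} {n : nat}.
Local Notation V := 'rV[R]_n.
Variables (phi f : V -> \bar R) (lambda : R).
Local Notation X := (edom phi).
Local Notation Y := ((edom phi)°).
Local Notation grad := (gradient phi).
Implicit Types (u v w x y z p d : V).
Hypotheses (phi_dgf : is_dgf phi) (phi_legendre : legendre phi)
  (phi_coercive : one_coercive phi) (f_proper : proper_fun X f)
  (lambda_gt0 : (0 < lambda)%R).

Definition dgf_sum x : \bar R :=
  if phi x < +oo then phi x + lambda%:E * f x else +oo.

Local Notation g := dgf_sum.

Let lambdaVK (r : R) : (lambda * (lambda^-1 * r) = r)%R.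
Proof. by rewrite mulrA mulfV ?gt_eqF// mul1r. Qed.

Lemma dgf_sumP x :
  (exists a r : R, [/\ phi x = a%:E, f x = r%:E & g x = (a + lambda * r)%:E]) \/
  (g x = +oo /\ (X x -> f x = +oo)).
Proof.
rewrite /dgf_sum; case: ifPn => [Xx|nXx]; last first.
  by right; split => //; rewrite /edom /= (negbTE nXx).
have [a xa] := dgf_fin phi_dgf Xx; have := f_proper.2 x Xx.
case fx : (f x) => [r| |] // _; [left; exists a, r|right].
  by rewrite xa -EFinM -EFinD.
by rewrite gt0_muley ?lte_fin// xa addey.
Qed.

Lemma dgf_sumE x (a r : R) : phi x = a%:E -> f x = r%:E ->
  g x = (a + lambda * r)%:E.
Proof. by rewrite /dgf_sum => -> ->; rewrite ltry -EFinM -EFinD. Qed.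

Lemma dgf_sum_proper : exists x, g x < +oo.
Proof.
case: f_proper => -[x Xx fx] _; exists x.
by case: (dgf_sumP x) => [[a [r [_ _ ->]]]|[_ /(_ Xx) fy]]; [exact: ltry|rewrite fy in fx].
Qed.

Lemma dgf_sum_dom x : g x < +oo -> X x.
Proof.
case: (dgf_sumP x) => [[a [r [xa _ _]]] _|[-> _]]; last by rewrite ltxx.
by rewrite /edom /= xa ltry.
Qed.

Lemma breg_fin z y (b a : R) : Y y -> phi z = b%:E -> phi y = a%:E ->
  breg phi z y = (b - a - dot (grad y) (z - y))%:E.
Proof. by move=> Yy zb ya; rewrite /breg mem_set// zb ya -!EFinB. Qed.

Lemma breg_symE x y : Y x -> Y y ->
  breg_sym phi x y = (dot (x - y) (grad x - grad y))%:E.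
Proof.
move=> Yx Yy; have [a xa] := dgf_fin phi_dgf (dgf_int Yx).
have [b yb] := dgf_fin phi_dgf (dgf_int Yy).
rewrite /breg_sym (breg_fin Yy xa yb) (breg_fin Yx yb xa) -EFinD; congr EFin.
by rewrite !dotE !(dotC _ (grad _)); ring.
Qed.

(** Multiply the minimality inequality by [lambda] and cancel the affine part
    of the Bregman distance. *)
Lemma left_prox_subdiff y x : Y y ->
  left_prox phi f lambda y x <-> subdifferential g x (grad y).
Proof.
move=> Yy; have [c yc] := dgf_fin phi_dgf (dgf_int Yy).
have objE z (b s : R) : phi z = b%:E -> f z = s%:E -> left_obj phi f lambda y z =
    (s + lambda^-1 * (b - c - dot (grad y) (z - y)))%:E.
  by move=> zb zs; rewrite /left_obj (breg_fin Yy zb yc) zs -EFinM -EFinD.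
have objy z : X z -> f z = +oo -> left_obj phi f lambda y z = +oo.
  move=> /(dgf_fin phi_dgf)[b zb] zy.
  by rewrite /left_obj (breg_fin Yy zb yc) zy -EFinM addye.
split=> [[_ [Xx minx]] z|xv].
  have [w gw] := dgf_sum_proper.
  have [[a [r [xa xr ->]]]|[_ /(_ Xx) fx]] := dgf_sumP x; last first.
    have Xw := dgf_sum_dom gw.
    have := minx w Xw; rewrite (objy x)//.
    case: (dgf_sumP w) gw => [[a [r [wa wr _]]] _|[-> _]]; last by rewrite ltxx.
    by rewrite (objE w a r)// leye_eq.
  have [[b [s [zb zs ->]]]|[-> _]] := dgf_sumP z; last by rewrite leey.
  have Xz : X z by rewrite /edom /= zb ltry.
  have := minx z Xz; rewrite (objE x a r)// (objE z b s)// !lee_fin.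
  rewrite -(ler_pM2l lambda_gt0) !mulrDr !lambdaVK.
  by rewrite !dotE; lra.
split=> //; have [w gw] := dgf_sum_proper.
have [[a [r [xa xr gx]]]|[gx _]] := dgf_sumP x; last first.
  by have := xv w; rewrite gx addye// leye_eq => /eqP gwy; rewrite gwy in gw.
split; first by rewrite /edom /= xa ltry.
move=> z Xz; have [[b [s [zb zs gz]]]|[_ /(_ Xz) zy]] := dgf_sumP z; last first.
  by rewrite (objy z)// leey.
rewrite (objE x a r)// (objE z b s)// !lee_fin.
rewrite -(ler_pM2l lambda_gt0) !mulrDr !lambdaVK.
by have := subdiff_le xv gx gz; rewrite !dotE; lra.
Qed.

Lemma left_subdiff_le x u z (a r b s : R) : left_subdiff phi f lambda x u ->
  phi x = a%:E -> f x = r%:E -> phi z = b%:E -> f z = s%:E ->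
  (r + dot u (z - x) - lambda^-1 * (b - a - dot (grad x) (z - x)) <= s)%R.
Proof.
move=> [Yx xu] xa xr zb zs.
have Xz : X z by rewrite /edom /= zb ltry.
by have := xu z Xz; rewrite (breg_fin Yx zb xa) xr zs -EFinM -EFinD lee_fin.
Qed.

Lemma left_subdiff_fin x u : left_subdiff phi f lambda x u ->
  exists a r : R, phi x = a%:E /\ f x = r%:E.
Proof.
move=> [Yx xu]; have [a xa] := dgf_fin phi_dgf (dgf_int Yx).
exists a; have [w gw] := dgf_sum_proper; have := xu w (dgf_sum_dom gw).
have := f_proper.2 x (dgf_int Yx); case: (dgf_sumP w) gw => [|[-> _]]; last by rewrite ltxx.
move=> [b [s [wb ws _]]] _; rewrite (breg_fin Yx wb xa) ws -EFinM.
by case: (f x) => [r| |] // _ _; exists r.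
Qed.

Lemma left_subdiff_subdiff x u : left_subdiff phi f lambda x u <->
  Y x /\ subdifferential g x (grad x + lambda *: u)%R.
Proof.
split=> [xu|[Yx xv]].
  have [a [r [xa xr]]] := left_subdiff_fin xu; split; first by case: xu.
  move=> z; have [[b [s [zb zs ->]]]|[-> _]] := dgf_sumP z; last by rewrite leey.
  rewrite (dgf_sumE xa xr) -EFinD lee_fin.
  have := ler_wpM2l (ltW lambda_gt0) (left_subdiff_le xu xa xr zb zs).
  rewrite mulrBr lambdaVK.
  by rewrite !dotE; lra.
split=> // z Xz; have [w gw] := dgf_sum_proper.
have [[a [r [xa xr gx]]]|[gx _]] := dgf_sumP x; last first.
  by have := xv w; rewrite gx addye// leye_eq => /eqP gwy; rewrite gwy in gw.
have [[b [s [zb zs gz]]]|[_ /(_ Xz) ->]] := dgf_sumP z; last by rewrite leey.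
rewrite (breg_fin Yx zb xa) xr zs -EFinM -EFinD lee_fin.
rewrite -(ler_pM2l lambda_gt0) mulrBr lambdaVK.
by have := subdiff_le xv gx gz; rewrite !dotE; lra.
Qed.

Section threshold.
Hypotheses (f_lsc : lsc_on X f) (lambda_lt : lambda%:E < prox_threshold phi f).

(** Some parameter [l > lambda] has a finite envelope, which bounds [lambda f]
    below by [- (lambda / l) phi] up to an affine function; the fraction
    [1 - lambda / l] of [phi] is left over. *)
Lemma dgf_sum_minorant : exists k M c : R, [/\ (0 < k)%R, (0 <= M)%R &
  forall z (b : R), phi z = b%:E -> (k * b - M * `|z| - c)%:E <= g z].
Proof.
have := lambda_lt; rewrite /prox_threshold => /ereal_sup_gt[_ [l [l0 [y Yy ly]] <-]].
rewrite lte_fin => lambdal.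
have [c0 c0P] : exists c0 : R, c0%:E <= left_env phi f l y.
  case: (left_env _ _ _ _) ly => // [c _|_]; first by exists c.
  by exists 0%R; rewrite leey.
have [a ya] := dgf_fin phi_dgf (dgf_int Yy).
set q := (lambda / l)%R; have q0 : (0 < q)%R by rewrite divr_gt0.
have q1 : (q < 1)%R by rewrite ltr_pdivrMr// mul1r.
have N0 := norm1_ge0 (grad y).
exists (1 - q)%R, (q * norm1 (grad y))%R,
  (q * norm1 (grad y) * `|y| - lambda * c0 - q * a)%R.
split; [by rewrite subr_gt0|by rewrite mulr_ge0// ltW|move=> z b zb].
have [[b' [s [zb' zs ->]]]|[-> _]] := dgf_sumP z; last by rewrite leey.
have bb' : b' = b by move: zb; rewrite zb' => -[].
have Xz : X z by rewrite /edom /= zb ltry.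
have : c0%:E <= left_obj phi f l y z.
  by apply: le_trans c0P _; apply: ereal_inf_lbound; exists z.
rewrite /left_obj (breg_fin Yy zb ya) zs -EFinM -EFinD !lee_fin bb'.
move=> /(ler_wpM2l (ltW lambda_gt0)); rewrite mulrDr mulrA -/q => H1.
have := dot_le_norm (grad y) (z - y)%R; rewrite ler_norml => /andP[H2 _].
have := ler_wpM2l (ltW q0) (ler_wpM2l N0 (ler_normB z y)).
have := ler_wpM2l (ltW q0) H2; lra.
Qed.

Lemma dgf_sum_supercoercive : supercoercive g.
Proof.
have [k [M [c [k0 M0 gM]]]] := dgf_sum_minorant.
move=> m; have [C phiC] := dgf_supercoercive phi_dgf phi_legendre phi_coercive ((m + M) / k)%R.
exists (c + k * C)%R => z.
have [Xz|] := boolP (phi z < +oo); last by rewrite /dgf_sum => /negbTE ->; rewrite leey.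
have [b zb] := dgf_fin phi_dgf Xz; apply: le_trans (gM z b zb); rewrite lee_fin.
have := phiC z; rewrite zb lee_fin -(ler_pM2l k0).
have -> : (k * ((m + M) / k * `|z| - C) = (m + M) * `|z| - k * C)%R.
  by field; rewrite gt_eqF.
lra.
Qed.

(** At points of [dom phi] both terms are lower semicontinuous.  At the others
    [phi] tends to [+oo], and the minorant carries this over to [phi + lambda f]. *)
Lemma dgf_sum_lsc : lower_semicontinuous g.
Proof.
have [k [M [c [k0 M0 gM]]]] := dgf_sum_minorant.
move=> x a ax; exists [set y | a%:E < g y] => //.
have [Xx|nXx] := boolP (phi x < +oo).
  have : a%:E < phi x + lambda%:E * f x by move: ax; rewrite /dgf_sum Xx.
  have fx := f_proper.2 x Xx.
  have Lf : -oo < lambda%:E * f x.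
    case: (f x) fx => [r| |] // _; first by rewrite -EFinM ltNyr.
    by rewrite gt0_muley ?lte_fin.
  move=> /(lt_adde_split (dgf_gtNy phi_dgf x) Lf)[b [s [bx sx bs]]].
  have sx' : (s / lambda)%:E < f x by rewrite EFinM lte_pdivrMr// muleC.
  apply: filterS2 (lsc_near (dgf_lsc phi_dgf) bx) (lsc_on_near f_lsc Xx sx').
  move=> y /= yb ys; rewrite /dgf_sum; case: ifPn => [Xy|_]; last exact: ltry.
  have := ys Xy; rewrite EFinM lte_pdivrMr// muleC => ys'.
  by apply: le_lt_trans (lteD yb ys'); rewrite -EFinD lee_fin.
set B := ((a + M * (`|x| + 1) + c) / k)%R.
have xB : B%:E < phi x.
  by move: nXx; rewrite -leNgt leye_eq => /eqP ->; rewrite ltry.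
apply: filterS2 (lsc_near (dgf_lsc phi_dgf) xB) (near_dist x ltr01).
move=> y /= yB yx; have [Xy|] := boolP (phi y < +oo); last first.
  by rewrite /dgf_sum => /negbTE ->; rewrite ltry.
have [b yb] := dgf_fin phi_dgf Xy; apply: lt_le_trans (gM y b yb); rewrite lte_fin.
move: yB; rewrite yb lte_fin ltr_pdivrMr//.
have : (`|y| <= `|x| + 1)%R.
  by have := lerB_dist y x; move: (ltW yx); lra.
move=> /(ler_wpM2l M0); lra.
Qed.

Hypothesis prox_range : forall x v, subdifferential g x v -> Y x.

Lemma left_subdiff_of_subdiff x v : subdifferential g x v ->
  left_subdiff phi f lambda x (lambda^-1 *: (v - grad x))%R.
Proof.
move=> xv; apply/left_subdiff_subdiff; split; first exact: prox_range xv.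
by rewrite scalerA mulfV ?gt_eqF// scale1r addrC subrK.
Qed.

Lemma left_subdiff_rel_monotone : monotone_op (left_subdiff phi f lambda) ->
  rel_monotone phi g.
Proof.
move=> mono x y u v xu yv.
have := mono (x, _) (y, _) (left_subdiff_of_subdiff xu) (left_subdiff_of_subdiff yv).
rewrite /= -scalerBr dotZr pmulr_rge0 ?invr_gt0// !dotE; lra.
Qed.

(** Convexity removes the Bregman term from the level proximal subgradient
    inequality: at [x + t (z - x)] this term is [o(t)], as [phi] is differentiable at
    [x]. *)
Lemma econvex_int_monotone : econvex_on Y f ->
  monotone_op (left_subdiff phi f lambda).
Proof.
move=> cvx.
have aff x u z (r s : R) : left_subdiff phi f lambda x u -> Y z ->
    f x = r%:E -> f z = s%:E -> (r + dot u (z - x) <= s)%R.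
  move=> xu Yz xr zs; have [Yx _] := xu.
  have [a xa] := dgf_fin phi_dgf (dgf_int Yx).
  apply/ler_addgt0Pr => e e0.
  case: (phi_dgf) => _ _ _ _ /(_ _ Yx) dphi.
  have [d d0 dP] := gradient_cvg (z - x)%R dphi (mulr_gt0 lambda_gt0 e0).
  pose t := (Num.min (2^-1) (d / 2))%R.
  have t0 : (0 < t)%R by rewrite lt_min !divr_gt0 ?invr_gt0 ?ltr0n//.
  have t1 : (t <= 2^-1)%R by rewrite ge_min lexx.
  have td : (t <= d / 2)%R by rewrite ge_min lexx orbT.
  have Yw : Y (x + t *: (z - x))%R.
    by apply: (dgf_segment phi_dgf Yx (dgf_int Yz)); lra.
  have [b wb] := dgf_fin phi_dgf (dgf_int Yw).
  have T01 : (0 < t < 1)%R by lra.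
  have := cvx z x t Yz Yx T01.
  have -> : (t *: z + (1 - t) *: x = x + t *: (z - x))%R.
    by apply/rowP => i; rewrite !mxE; ring.
  rewrite xr zs -!EFinM -EFinD => fw.
  have [q wq] : exists q, f (x + t *: (z - x))%R = q%:E.
    have := f_proper.2 _ (dgf_int Yw); move: fw.
    by case: (f (x + t *: (z - x))%R) => // q _ _; exists q.
  move: fw; rewrite wq lee_fin.
  have := left_subdiff_le xu xa xr wb wq.
  have -> : (x + t *: (z - x) - x = t *: (z - x))%R by rewrite addrC addKr.
  have := dP t; rewrite (gtr0_norm t0) wb xa /= => /(_ _)/wrap[|]; first by lra.
  rewrite ler_norml !dotZr => /andP[_ H1] H2 H3.
  have H4 : (lambda^-1 * (b - a - t * dot (grad x) (z - x)) <= e * t)%R.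
    by rewrite ler_pdivrMl//; lra.
  by rewrite -(ler_pM2l t0); lra.
move=> [x1 u1] [x2 u2] /= xu1 xu2.
have [a1 [r1 [_ xr1]]] := left_subdiff_fin xu1.
have [a2 [r2 [_ xr2]]] := left_subdiff_fin xu2.
have := aff _ _ _ _ _ xu1 xu2.1 xr1 xr2.
have := aff _ _ _ _ _ xu2 xu1.1 xr2 xr1.
by rewrite (dotC (x1 - x2)%R) !dotE; lra.
Qed.

(** Convexity of [(g - phi) / lambda], which is [f] on [dom phi]. *)
Lemma rel_monotone_econvex : rel_monotone phi g -> econvex_on X f.
Proof.
move=> gm x y t Xx Xy /andP[t0 t1].
have t1' : (0 < 1 - t)%R by rewrite subr_gt0.
have [x0 gx0] := dgf_sum_proper.
have := f_proper.2 y Xy; have := f_proper.2 x Xx.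
case xr : (f x) => [r| |] // _; case ys : (f y) => [s| |] // _;
  try by rewrite ?gt0_muley ?lte_fin// -?EFinM ?addey// ?addye// leey.
have [a xa] := dgf_fin phi_dgf Xx; have [b yb] := dgf_fin phi_dgf Xy.
set m := (_ + _)%R; have Xm : X m.
  have : phi m <= t%:E * phi x + (1 - t)%:E * phi y.
    by case: phi_dgf => _ _ cvx _ _; apply: cvx; rewrite ?t0.
  by rewrite xa yb -!EFinM -EFinD; exact: dgf_edom.
have [c mc] := dgf_fin phi_dgf Xm.
have T01 : (0 < t < 1)%R by rewrite t0.
have := @rel_convex _ _ phi g x0 phi_dgf phi_legendre dgf_sum_lsc
  dgf_sum_supercoercive gx0 dgf_sum_dom prox_range gm x y t _ _ a b c T01
  (dgf_sumE xa xr) (dgf_sumE yb ys) xa yb mc.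
rewrite -/m; have [[c' [q [mc' -> ->]]]|[-> _]] := dgf_sumP m; last by [].
move: mc; rewrite mc' => -[->]; rewrite lee_fin -!EFinM -EFinD lee_fin => H.
by rewrite -(ler_pM2l lambda_gt0); lra.
Qed.

End threshold.
End regularized_sum.

(** * Maximal monotonicity and the equivalences *)

(** Minty: if [(v, x)] is monotonically related to the graph, solve
    [v + x - z] in the subdifferential at [z]; then [- |z - x|^2 >= 0]. *)
Lemma max_monotone_subdiff {R : realType} {n : nat} (g : 'rV[R]_n -> \bar R)
    (T : 'rV[R]_n -> set 'rV[R]_n) :
  supercoercive g -> (exists x, g x < +oo)%E ->
  (forall v x, T v x <-> subdifferential g x v) ->
  (forall w, exists x, subdifferential g x (w - x)) ->
  max_monotone T.
Proof.
move=> gsc [x0 gx0] TE res; split => //.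
  move=> [v x] [w y] /= /TE xv /TE yw.
  have [a xa] := subdiff_fin gsc gx0 xv; have [b yb] := subdiff_fin gsc gx0 yw.
  have := subdiff_le xv xa yb; have := subdiff_le yw yb xa.
  by rewrite !dotE; lra.
move=> [S [_ monoS [TS nST]]]; apply: nST => -[v x] Svx.
have [z zv] := res (v + x); have /TE Tz := zv.
have := monoS _ _ (TS (_, z) Tz) Svx => /=.
have -> : v + x - z - v = - (z - x) by apply/rowP => i; rewrite !mxE; ring.
rewrite dotNl oppr_ge0 => /dotxx_le0/subr0_eq zx.
by rewrite zx addrK in Tz.
Qed.

Local Open Scope ereal_scope.

Theorem theorem4p13 (R : realType) (n : nat) (phi f : 'rV[R]_n -> \bar R)
    (lambda : R)
    (phi_dgf : is_dgf phi) (phi_legendre : legendre phi)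
    (phi_coercive : one_coercive phi)
    (f_proper : proper_fun (edom phi) f) (f_lsc : lsc_on (edom phi) f)
    (f_prox_bounded : prox_bounded phi f)
    (lambda_gt0 : (0 < lambda)%R)
    (lambda_lt : lambda%:E < prox_threshold phi f)
    (prox_range :
      \bigcup_(y in (edom phi)°) left_prox phi f lambda y `<=` (edom phi)°) :
  let Cvx := econvex_on (edom phi) f in
  let CvxInt := econvex_on (edom phi)° f in
  let Mono := monotone_op (left_subdiff phi f lambda) in
  let MaxMono := max_monotone_rel (edom phi)° (left_subdiff phi f lambda) in
  let FirmIneq := forall y1 y2 x1 x2 : 'rV[R]_n,
    (edom phi)° y1 -> (edom phi)° y2 ->
    left_prox phi f lambda y1 x1 -> left_prox phi f lambda y2 x2 ->
    breg_sym phi x1 x2 <=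
    (dot (x1 - x2)%R (gradient phi y1 - gradient phi y2)%R)%:E in
  let Firm := exists2 T : 'rV[R]_n -> 'rV[R]_n,
    (forall y : 'rV[R]_n, (edom phi)° y -> left_prox phi f lambda y = [set T y]) &
    breg_firmly_nonexpansive phi T in
  [<-> Cvx; CvxInt; Mono; MaxMono; FirmIneq; Firm] /\
  ([\/ Cvx, CvxInt, Mono | MaxMono] \/ FirmIneq \/ Firm ->
   max_monotone
     (fun v => left_prox phi f lambda (gradient (conjugate phi) v))).
Proof.
move=> Cvx CvxInt Mono MaxMono FirmIneq Firm.
pose g := dgf_sum phi f lambda.
have surj v : exists2 y, (edom phi)° y & gradient phi y = v.
  exact: gradient_surj.
have proxE y x : (edom phi)° y ->
    left_prox phi f lambda y x <-> subdifferential g x (gradient phi y).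
  exact: left_prox_subdiff.
have range x v : subdifferential g x v -> (edom phi)° x.
  have [y Yy <-] := surj v => xv; apply: prox_range; exists y => //.
  exact/proxE.
have glsc : lower_semicontinuous g by exact: dgf_sum_lsc.
have gsc : supercoercive g by exact: dgf_sum_supercoercive.
have [x0 gx0] : exists x, g x < +oo by exact: dgf_sum_proper.
have Cvx_int : Cvx -> CvxInt.
  by move=> cvx x y t Yx Yy; apply: cvx; exact: dgf_int.
have int_Mono : CvxInt -> Mono by exact: econvex_int_monotone.
have Mono_rel : Mono -> rel_monotone phi g by exact: left_subdiff_rel_monotone.
have Mono_Max : Mono -> MaxMono.
  move=> mono; split=> //; first by move=> [x u] [Yx _].
  move=> [S [SY monoS [TS nST]]]; apply: nST => -[x u] Sxu.
  have [Yx _] := SY _ Sxu.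
  have [z zv] := subdiff_exists glsc gsc gx0 (gradient phi x + lambda *: u)%R.
  have zu := left_subdiff_of_subdiff phi_dgf f_proper lambda_gt0 range zv.
  have := monoS _ _ (TS (z, _) zu) Sxu => /=.
  have -> : (lambda^-1 *: (gradient phi x + lambda *: u - gradient phi z) - u =
      - (lambda^-1 *: (gradient phi z - gradient phi x)))%R.
    by apply/rowP => i; rewrite !mxE; field; rewrite gt_eqF.
  rewrite dotNr dotZr oppr_ge0 pmulr_rle0 ?invr_gt0// dotC => zx0.
  have zx : z = x.
    apply: contrapT.
    move=> /(gradient_strict_mono phi_dgf phi_legendre (range _ _ zv) Yx).
    by rewrite ltNge zx0.
  by apply/left_subdiff_subdiff => //; rewrite -{2}zx.
have Max_Firm : MaxMono -> FirmIneq.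
  move=> [_ /Mono_rel gm _] y1 y2 x1 x2 Yy1 Yy2.
  move=> /(proxE _ _ Yy1) x1v /(proxE _ _ Yy2) x2v.
  rewrite breg_symE ?lee_fin//; [exact: gm|exact: range x1v|exact: range x2v].
have Firm_ineq : FirmIneq -> Firm.
  move=> firm.
  have [T TP] := choice (fun y => subdiff_exists glsc gsc gx0 (gradient phi y)).
  have TY y : (edom phi)° (T y) by exact: range (TP y).
  exists T; last first.
    split=> // y1 y2 Yy1 Yy2; apply: firm => //; exact/proxE.
  move=> y Yy; apply/seteqP; split=> [x xy|_ ->]; last exact/proxE.
  have Yx : (edom phi)° x by apply: prox_range; exists y.
  have Ty : left_prox phi f lambda y (T y) by exact/proxE.
  apply: contrapT.
  move=> /(gradient_strict_mono phi_dgf phi_legendre Yx (TY y)).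
  have := firm y y x (T y) Yy Yy xy Ty.
  by rewrite breg_symE// subrr dot0r lee_fin dotC leNgt => /negbTE ->.
have Firm_rel : Firm -> rel_monotone phi g.
  move=> [T Tprox [_ firm]] x1 x2 v1 v2.
  have [y1 Yy1 <-] := surj v1; have [y2 Yy2 <-] := surj v2 => x1v x2v.
  have := (proxE _ _ Yy1).2 x1v; rewrite Tprox// => /= x1T.
  have := (proxE _ _ Yy2).2 x2v; rewrite Tprox// => /= x2T.
  have := firm y1 y2 Yy1 Yy2; rewrite -x1T -x2T breg_symE ?lee_fin//.
  - exact: range x1v.
  - exact: range x2v.
have rel_Cvx : rel_monotone phi g -> Cvx by exact: rel_monotone_econvex.
have Firm_Cvx : Firm -> Cvx by move=> /Firm_rel.
split; first by tfae.
move=> H; have gm : rel_monotone phi g.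
  case: H => [[/Cvx_int/int_Mono|/int_Mono||[_ + _]]|[/Firm_ineq|]];
    by [exact: Mono_rel|exact: Firm_rel].
have inj : forall v x y, subdifferential g x v -> subdifferential g y v -> x = y.
  exact: (rel_monotone_inj phi_dgf phi_legendre range gm).
apply: (@max_monotone_subdiff _ _ g) => //; first by exists x0.
- move=> v x; have [y Yy <-] := surj v.
  by rewrite gradient_conjugate//; exact: proxE.
- move=> w; have [x] := subdiff_resolvent glsc gsc gx0 inj w ltr01.
  by rewrite scale1r; exists x.
Qed.
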